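(* The controller gain $$K(\Delta)=\left(L_m^T(\Delta)\,V_{\tilde W}\right)\left(L_n^T(\Delta)\,\tilde Y\,L_n(\Delta)\right)^{-1}$$ (with control law $u=K(\Delta)x(t,\Delta)$) minimizes the cost $$\min_u\ \mathbf{E}\left[\int_0^\infty\left(x^TQx+u^TRu\right)dt\right]$$ for the system $\dot x=A(\Delta)x+B(\Delta)u$ if there exist matrices $\tilde Y=\tilde Y^T>0$ in $\mathbb{R}^{n(N+1)\times n(N+1)}$ and $\tilde W_i\in\mathbb{R}^{m\times n}$ ($i=0,\dots,N$) that solve the optimization problem $$\max_{\tilde Y,\,\tilde W_i}\ \mathrm{tr}\left(\sum_{i=0}^N\mathbf{E}[l_i\otimes I_n]\,\tilde Y_{ii}\right)$$ subject to $$\begin{bmatrix}M_{11,i}&M_{12,i}&M_{13,i}\\ M_{12,i}^T&-I&0\\ M_{13,i}^T&0&-I\end{bmatrix}\le0\qquad\text{for } i=0,1,\dots,N,$$ where $$M_{11,i}:=\mathrm{sym}\left(\tilde Y_{ii}^T\,\mathbf{E}[l_i\otimes I_n]\,A^T(\Delta_i)+\tilde W_i^T\,\mathbf{E}[l_i\otimes I_m]\,B^T(\Delta_i)\right),$$ $$M_{12,i}:=\tilde Y_{ii}^T\sqrt{\mathbf{E}[l_i\otimes I_n]\,Q},\qquad M_{13,i}:=\tilde W_i^T\sqrt{\mathbf{E}[l_i\otimes I_m]\,R},$$ and $\Delta_0,\dots,\Delta_N$ are the roots of the polynomial chaos basis polynomial of degree $N+1$.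
   Context: Setting. $\Delta$ is a random parameter (not varying in time; scalar here, since the collocation nodes are roots of a univariate polynomial) with probability density $f_\Delta$ on its domain $\mathcal{D}_\Delta$; $\mathbf{E}[\cdot]$ is expectation with respect to $f_\Delta$. The system is $\dot x=A(\Delta)x+B(\Delta)u$ with $A(\Delta)\in\mathbb{R}^{n\times n}$, $B(\Delta)\in\mathbb{R}^{n\times m}$, solution $x=x(t,\Delta)\in\mathbb{R}^n$, and given initial state $x(0)=x_0$ without uncertainty. Controls are state feedbacks $u=K(\Delta)x(t,\Delta)$, $K(\Delta)\in\mathbb{R}^{m\times n}$. $Q\in\mathbb{R}^{n\times n}$, $R\in\mathbb{R}^{m\times m}$ are the symmetric positive semidefinite state and control weights. $\mathrm{sym}(X):=X+X^T$; $\sqrt{\cdot}$ is the principal matrix square root; $\otimes$ is the Kronecker product. Collocation basis. $\{\phi_i\}$ are the polynomial chaos basis polynomials, orthogonal with respect to $f_\Delta$ ($\mathbf{E}[\phi_i\phi_j]=0$ for $i\ne j$). With $\Delta_0,\dots,\Delta_N$ the roots of the basis polynomial of degree $N+1$, the Lagrangian interpolants are $l_i(\Delta)=\prod_{j=0,\,j\ne i}^N\frac{\Delta-\Delta_j}{\Delta_i-\Delta_j}$. Define $L_k(\Delta):=[l_0(\Delta),\dots,l_N(\Delta)]^T\otimes I_k$ for $k=n,m$. The formulation is based on the finite-term collocation expansion $x(t,\Delta)\approx\sum_{i=0}^Nx_{i,sc}(t)l_i(\Delta)$. Parameterization. $\tilde Y=[\tilde Y_{ij}]_{i,j=0}^N$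 is partitioned into $n\times n$ blocks, $V_{\tilde W}:=\begin{bmatrix}\tilde W_0\\ \vdots\\ \tilde W_N\end{bmatrix}$, $Y(\Delta)=L_n^T(\Delta)\tilde YL_n(\Delta)$ and $W(\Delta)=L_m^T(\Delta)V_{\tilde W}$. In the matrix inequality the identity blocks have sizes $n$ and $m$; $\le0$ means negative semidefinite, $>0$ positive definite.
   Formalization: The cost is evaluated on the finite-term collocation expansions of both x and u, not on the exact x and u; and when Q is not positive definite, only state feedbacks whose expanded state tends to 0 in mean square compete in the minimum. Both literal claims are false. *)

(* Defs.v *)
From mathcomp Require Export all_boot all_order all_algebra.
From mathcomp Require Export all_classical all_reals all_analysis.
Set Implicit Arguments.
Unset Strict Implicit.
Unset Printing Implicit Defensive.
Import Order.TTheory GRing.Theory Num.Theory.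
Import numFieldNormedType.Exports.
Local Open Scope classical_set_scope.
Local Open Scope ring_scope.

Section Matrices.
Variable R : realType.

Definition quadf n (M : 'M[R]_n) (x : 'cV[R]_n) : R := (x^T *m M *m x) 0 0.

Definition psdmx n (M : 'M[R]_n) : Prop :=
  M^T = M /\ forall x : 'cV[R]_n, 0 <= quadf M x.

Definition posdefmx n (M : 'M[R]_n) : Prop :=
  M^T = M /\ forall x : 'cV[R]_n, x != 0 -> 0 < quadf M x.

Definition nsdmx n (M : 'M[R]_n) : Prop := psdmx (- M).

Definition sym n (X : 'M[R]_n) : 'M[R]_n := X + X^T.

(* The principal square root of a positive semidefinite matrix X is its unique
   positive semidefinite square root; the default value 0 only concerns
   matrices without such a root. *)
Definition sqrtmx n (X : 'M[R]_n) : 'M[R]_n :=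
  xget 0 [set S : 'M[R]_n | psdmx S /\ S *m S = X].

End Matrices.

Section Expectation.
Variables (R : realType) (D : set R) (f : R -> R).

Definition is_density : Prop :=
  [/\ measurable D, measurable_fun D f, (forall d, D d -> 0 <= f d)
    & (\int[lebesgue_measure]_(d in D) (f d)%:E = 1)%E].

Definition Ex (g : R -> R) : R :=
  Rintegral lebesgue_measure D (fun d => g d * f d).

(* Expectation of a nonnegative, possibly infinite, quantity. *)
Definition Exe (g : R -> \bar R) : \bar R :=
  (\int[lebesgue_measure]_(d in D) (g d * (f d)%:E))%E.

Definition Emx p q (G : R -> 'M[R]_(p, q)) : 'M[R]_(p, q) :=
  \matrix_(i, j) Ex (fun d => G d i j).

Definition is_pc_basis (phi : nat -> {poly R}) : Prop :=
  [/\ (forall i, size (phi i) = i.+1),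
      (forall i j, lebesgue_measure.-integrable D
         (fun d => ((phi i).[d] * (phi j).[d] * f d)%:E))
    & (forall i j, i != j -> Ex (fun d => (phi i).[d] * (phi j).[d]) = 0)].

(* p has degree N+1, so N+1 pairwise distinct roots are all of its roots. *)
Definition are_roots N (p : {poly R}) (node : 'I_N.+1 -> R) : Prop :=
  injective node /\ forall i, root p (node i).

End Expectation.

Section Collocation.
Variables (R : realType) (N : nat) (node : 'I_N.+1 -> R).

Definition lagr (i : 'I_N.+1) (d : R) : R :=
  \prod_(j < N.+1 | j != i) ((d - node j) / (node i - node j)).

(* [l_0, .., l_N]^T (x) I_k, i.e. the block column of the l_i I_k; the Kronecker
   product of the scalar l_i with I_k is the scalar matrix (l_i)%:M. *)
Definition Lmx k (d : R) : 'M[R]_(\sum_(i < N.+1) k, k) :=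
  \mxcol_(i < N.+1) ((lagr i d)%:M : 'M[R]_k).

Definition expansion p (g : R -> 'cV[R]_p) (d : R) : 'cV[R]_p :=
  \sum_(i < N.+1) lagr i d *: g (node i).

End Collocation.

Section Program.
Variables (R : realType) (N n m : nat).
Variables (D : set R) (f : R -> R) (node : 'I_N.+1 -> R).
Variables (A : R -> 'M[R]_n) (B : R -> 'M[R]_(n, m)).
Variables (Q : 'M[R]_n) (Rw : 'M[R]_m).

(* E[l_i (x) I_k] *)
Definition EL k (i : 'I_N.+1) : 'M[R]_k :=
  Emx D f (fun d => (lagr node i d)%:M : 'M[R]_k).

Variables (Y : 'M[R]_(\sum_(i < N.+1) n)) (W : 'I_N.+1 -> 'M[R]_(m, n)).

Definition Yblk (i : 'I_N.+1) : 'M[R]_n := submxblock Y i i.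

Definition M11 (i : 'I_N.+1) : 'M[R]_n :=
  sym ((Yblk i)^T *m EL n i *m (A (node i))^T
       + (W i)^T *m EL m i *m (B (node i))^T).
Definition M12 (i : 'I_N.+1) : 'M[R]_n := (Yblk i)^T *m sqrtmx (EL n i *m Q).
Definition M13 (i : 'I_N.+1) : 'M[R]_(n, m) :=
  (W i)^T *m sqrtmx (EL m i *m Rw).

Definition LMI (i : 'I_N.+1) : 'M[R]_(n + (n + m)) :=
  block_mx (M11 i) (row_mx (M12 i) (M13 i))
           (col_mx (M12 i)^T (M13 i)^T)
           (block_mx (- 1%:M) 0 0 (- 1%:M)).

Definition feasible : Prop := posdefmx Y /\ forall i, nsdmx (LMI i).

Definition objective : R := \tr (\sum_(i < N.+1) EL n i *m Yblk i).

Definition gain (d : R) : 'M[R]_(m, n) :=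
  ((Lmx node m d)^T *m \mxcol_(i < N.+1) W i)
  *m invmx ((Lmx node n d)^T *m Y *m Lmx node n d).

End Program.

Definition solves_program (R : realType) (N n m : nat) (D : set R) (f : R -> R)
    (node : 'I_N.+1 -> R) (A : R -> 'M[R]_n) (B : R -> 'M[R]_(n, m))
    (Q : 'M[R]_n) (Rw : 'M[R]_m)
    (Y : 'M[R]_(\sum_(i < N.+1) n)) (W : 'I_N.+1 -> 'M[R]_(m, n)) : Prop :=
  feasible D f node A B Q Rw Y W /\
  forall (Y' : 'M[R]_(\sum_(i < N.+1) n)) (W' : 'I_N.+1 -> 'M[R]_(m, n)),
    feasible D f node A B Q Rw Y' W' ->
    objective D f node Y' <= objective D f node Y.

Section Regulator.
Variables (R : realType) (N n m : nat).
Variables (D : set R) (f : R -> R) (node : 'I_N.+1 -> R).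
Variables (A : R -> 'M[R]_n) (B : R -> 'M[R]_(n, m)).
Variables (Q : 'M[R]_n) (Rw : 'M[R]_m) (x0 : 'cV[R]_n).

(* x(t, d) solves x' = A(d) x + B(d) u with u = K(d) x on [0, +oo[. *)
Definition closed_loop (K : R -> 'M[R]_(m, n)) (x : R -> R -> 'cV[R]_n) : Prop :=
  forall d : R,
  [/\ x 0 d = x0,
      (forall k : 'I_n, {within `[0, +oo[, continuous (fun t : R => x t d k 0)})
    & (forall (t : R) (k : 'I_n), 0 < t -> is_derive t 1 (fun s : R => x s d k 0)
         ((A d *m x t d + B d *m (K d *m x t d)) k 0))].

(* State and control are represented by their finite-term collocation expansions
   sum_i x(t, Delta_i) l_i and sum_i u(t, Delta_i) l_i. *)
Definition x_sc (x : R -> R -> 'cV[R]_n) (t d : R) : 'cV[R]_n :=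
  expansion node (x t) d.
Definition u_sc (K : R -> 'M[R]_(m, n)) (x : R -> R -> 'cV[R]_n) (t d : R) :
    'cV[R]_m :=
  expansion node (fun e => K e *m x t e) d.

Definition cost (K : R -> 'M[R]_(m, n)) (x : R -> R -> 'cV[R]_n) : \bar R :=
  Exe D f (fun d => (\int[lebesgue_measure]_(t in `[0%R, +oo[)
    (quadf Q (x_sc x t d) + quadf Rw (u_sc K x t d))%:E)%E).

Definition regulated (x : R -> R -> 'cV[R]_n) : Prop :=
  Ex D f (fun d => quadf 1%:M (x_sc x t d)) @[t --> +oo] --> (0 : R).

(* If Q is positive definite, every state feedback competes. If Q is singular,
   a feedback may leave an unstable mode invisible to the cost, and (as usual
   for regulators) only feedbacks driving the state to 0 in mean square
   compete: with n = m = 1, A = B = R = 1, Q = 0, the feedback K = 0 has cost 0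
   but an exploding state. *)
Definition minimizes_cost (K : R -> 'M[R]_(m, n)) : Prop :=
  forall x, closed_loop K x ->
    regulated x /\
    forall K' x', closed_loop K' x' -> posdefmx Q \/ regulated x' ->
      (cost K x <= cost K' x')%E.

End Regulator.

(* Main.v *)
(* Since l_i(Delta_j) = delta_ij and, by Gauss quadrature,
   E[l_i l_j] = delta_ij w_i with w_i = E[l_i] > 0, the cost is sum_i w_i J_i,
   where J_i is the quadratic cost at node i alone, and the program decouples:
   with P = Y_ii^-1 and K = W_i P, a Schur complement turns the i-th matrix
   inequality into the Riccati inequality
     (A + B K)^T P + P (A + B K) + Q + K^T R K <= 0,
   and (P, K) maximizes tr P^-1 among its solutions. Maximality forces equality
   in it, stability of A + B K, and B^T P + R K = 0: whenever one of these fails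
   an explicit smaller P (or a better K) is admissible. Hence along any
   trajectory
     x^T Q x + u^T R u + d/dt (x^T P x) = (u - K x)^T R (u - K x) >= 0,
   so J_i >= x0^T P x0, with equality for u = K x. *)
From mathcomp Require Import measurable_realfun ring lra.
Require Import Defs.
Import Order.TTheory GRing.Theory Num.Theory.
Import numFieldNormedType.Exports.
Local Open Scope classical_set_scope.
Local Open Scope ring_scope.
Set Implicit Arguments.
Unset Strict Implicit.
Unset Printing Implicit Defensive.

(** Maximality is only an inequality between traces of inverses, and it is exploited through one
    fact: a positive semidefinite [Z] for which [P - Z] is still admissible must vanish, inversion
    being strictly antitone for the trace. The natural candidates for [Z] are integrals and limits
    along [exp(t (A + B K))]; powers of a Cayley transform replace that flow, which leaves matrix
    algebra and one monotone limit. Such a [Z] satisfies only [Z <= P], so half of it is subtracted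
    to stay positive definite. Stability is extracted not as a spectral statement but as a quadratic
    Lyapunov function with a decay rate, the form in which trajectories use it. For a competing
    feedback no stability is known: the boundary term [x^T P x] at infinity is removed by the
    convergence hypothesis or, for positive definite [Q], because a finite cost forces it to come
    close to 0. *)

Section EntryRules.
Variable V : pzRingType.

Lemma addmxE p q (A B : 'M[V]_(p, q)) i j : (A + B) i j = A i j + B i j.
Proof. by rewrite mxE. Qed.

Lemma oppmxE p q (A : 'M[V]_(p, q)) i j : (- A) i j = - A i j.
Proof. by rewrite mxE. Qed.

Lemma scalemxE p q (c : V) (A : 'M[V]_(p, q)) i j : (c *: A) i j = c * A i j.
Proof. by rewrite mxE. Qed.

Lemma mx0E p q i j : (0 : 'M[V]_(p, q)) i j = 0.
Proof. by rewrite mxE. Qed.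

Lemma trmxD p q (A B : 'M[V]_(p, q)) : (A + B)^T = A^T + B^T.
Proof. exact: linearD. Qed.

Lemma trmxN p q (A : 'M[V]_(p, q)) : (- A)^T = - A^T.
Proof. exact: linearN. Qed.

Lemma trmxZ p q (c : V) (A : 'M[V]_(p, q)) : (c *: A)^T = c *: A^T.
Proof. by apply/matrixP=> i j; rewrite !mxE. Qed.
End EntryRules.

(* Expands products of matrices and compares the two sides entrywise, each
   noncommutative monomial being an atom. Opposites are matched syntactically:
   unifying [- _] with an arbitrary factor is very slow. *)
Ltac mxexpand :=
  repeat match goal with
  | |- context [ (?a + ?b)^T ] => rewrite (trmxD a b)
  | |- context [ (- ?a)^T ] => rewrite (trmxN a)
  | |- context [ (?c *: ?a)^T ] => rewrite (trmxZ c a)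
  | |- context [ (?a *m ?b)^T ] => rewrite (trmx_mul a b)
  end;
  rewrite ?trmx1 ?trmxK;
  repeat match goal with
  | |- context [ ?a *m (?b + ?c) ] => rewrite (mulmxDr a b c)
  | |- context [ (?a + ?b) *m ?c ] => rewrite (mulmxDl a b c)
  | |- context [ ?a *m - ?b ] => rewrite (mulmxN a b)
  | |- context [ - ?a *m ?b ] => rewrite (mulNmx a b)
  end;
  rewrite ?(mulmxA, mulmx1, mul1mx, mulmx0, mul0mx);
  rewrite -?scalemxAl -?scalemxAr ?mulmxA.
Ltac mxabel := apply/matrixP=> ? ?;
  rewrite ?(addmxE, oppmxE, scalemxE, mx0E); ring.

(** * Quadratic forms and semidefinite matrices *)

Section QuadraticForms.
Variable R : realType.
Implicit Types (n : nat).

Lemma unitmx_of_inj n (A : 'M[R]_n) :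
  (forall x : 'cV_n, A *m x = 0 -> x = 0) -> A \in unitmx.
Proof.
move=> Ainj; rewrite -unitmx_tr -row_free_unit; apply: inj_row_free => v vA.
by apply: trmx_inj; rewrite trmx0; apply: Ainj; apply: trmx_inj;
  rewrite trmx_mul trmxK vA trmx0.
Qed.

Lemma mx00D (x y : 'M[R]_1) : (x + y) 0 0 = x 0 0 + y 0 0.
Proof. by rewrite mxE. Qed.

Definition bilf n (M : 'M[R]_n) (x y : 'cV[R]_n) : R := (x^T *m M *m y) 0 0.

Lemma bilfDl n (M : 'M[R]_n) x y z : bilf M (x + y) z = bilf M x z + bilf M y z.
Proof. by rewrite /bilf linearD /= !mulmxDl addmxE. Qed.

Lemma bilfDr n (M : 'M[R]_n) x y z : bilf M z (x + y) = bilf M z x + bilf M z y.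
Proof. by rewrite /bilf mulmxDr addmxE. Qed.

Lemma bilfZl n (M : 'M[R]_n) c x z : bilf M (c *: x) z = c * bilf M x z.
Proof. by rewrite /bilf linearZ /= -!scalemxAl scalemxE. Qed.

Lemma bilfZr n (M : 'M[R]_n) c x z : bilf M z (c *: x) = c * bilf M z x.
Proof. by rewrite /bilf -scalemxAr scalemxE. Qed.

Lemma bilf_tr n (M : 'M[R]_n) x y : bilf M^T x y = bilf M y x.
Proof.
rewrite /bilf -[in RHS](trmxK (y^T *m M *m x)) [in RHS]mxE.
by rewrite !trmx_mul trmxK mulmxA.
Qed.

Lemma bilfC n (M : 'M[R]_n) x y : M^T = M -> bilf M x y = bilf M y x.
Proof. by move=> Ms; rewrite -{1}Ms bilf_tr. Qed.

Lemma quadfE n (M : 'M[R]_n) x : quadf M x = bilf M x x.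
Proof. by []. Qed.

Lemma quadfD n (M N : 'M[R]_n) x : quadf (M + N) x = quadf M x + quadf N x.
Proof. by rewrite /quadf mulmxDr mulmxDl addmxE. Qed.

Lemma quadfN n (M : 'M[R]_n) x : quadf (- M) x = - quadf M x.
Proof. by rewrite /quadf mulmxN mulNmx oppmxE. Qed.

Lemma quadfB n (M N : 'M[R]_n) x : quadf (M - N) x = quadf M x - quadf N x.
Proof. by rewrite quadfD quadfN. Qed.

Lemma quadfZ n c (M : 'M[R]_n) x : quadf (c *: M) x = c * quadf M x.
Proof. by rewrite /quadf -scalemxAr -scalemxAl scalemxE. Qed.

Lemma quadf0 n x : quadf (0 : 'M[R]_n) x = 0.
Proof. by rewrite /quadf mulmx0 mul0mx mxE. Qed.

Lemma quadf_0r n (M : 'M[R]_n) : quadf M 0 = 0.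
Proof. by rewrite /quadf mulmx0 mxE. Qed.

Lemma quadf_congr n p (M : 'M[R]_n) (C : 'M[R]_(n, p)) x :
  quadf (C^T *m M *m C) x = quadf M (C *m x).
Proof. by rewrite /quadf trmx_mul !mulmxA. Qed.

Lemma quadf1 n (x : 'cV[R]_n) : quadf 1%:M x = \sum_i x i 0 ^+ 2.
Proof.
by rewrite /quadf mulmx1 mxE; apply: eq_bigr => i _; rewrite mxE expr2.
Qed.

Lemma quadf1_ge0 n (x : 'cV[R]_n) : 0 <= quadf 1%:M x.
Proof. by rewrite quadf1; apply: sumr_ge0 => i _; exact: sqr_ge0. Qed.

Lemma quadf1_eq0 n (x : 'cV[R]_n) : quadf 1%:M x = 0 -> x = 0.
Proof.
rewrite quadf1 => /eqP; rewrite psumr_eq0 => [/allP x0|i _]; last exact: sqr_ge0.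
apply/matrixP=> i j; rewrite ord1 mxE; apply/eqP.
by have /implyP := x0 i (mem_index_enum _); rewrite sqrf_eq0; apply.
Qed.

Lemma psdmx0 n : psdmx (0 : 'M[R]_n).
Proof. by split => [|x]; rewrite ?trmx0 ?quadf0. Qed.

Lemma psdmx1 n : psdmx (1%:M : 'M[R]_n).
Proof. by split => [|x]; rewrite ?trmx1 ?quadf1_ge0. Qed.

Lemma psdmxD n (M N : 'M[R]_n) : psdmx M -> psdmx N -> psdmx (M + N).
Proof.
move=> [Ms M0] [Ns N0]; split => [|x]; first by rewrite linearD /= Ms Ns.
by rewrite quadfD addr_ge0.
Qed.

Lemma psdmxZ n c (M : 'M[R]_n) : 0 <= c -> psdmx M -> psdmx (c *: M).
Proof.
move=> c0 [Ms M0]; split => [|x]; first by rewrite linearZ /= Ms.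
by rewrite quadfZ mulr_ge0.
Qed.

Lemma psdmx_congr n p (M : 'M[R]_n) (C : 'M[R]_(n, p)) :
  psdmx M -> psdmx (C^T *m M *m C).
Proof.
move=> [Ms M0]; split => [|x]; last by rewrite quadf_congr.
by rewrite !trmx_mul trmxK Ms mulmxA.
Qed.

Lemma psdmx_gram n p (C : 'M[R]_(n, p)) : psdmx (C^T *m C).
Proof. by rewrite -[C^T]mulmx1; apply: psdmx_congr; exact: psdmx1. Qed.

Lemma posdef_psd n (M : 'M[R]_n) : posdefmx M -> psdmx M.
Proof.
move=> [Ms M0]; split=> // x; have [->|/M0/ltW//] := eqVneq x 0.
by rewrite quadf_0r.
Qed.

Lemma posdefDl n (M N : 'M[R]_n) : posdefmx M -> psdmx N -> posdefmx (M + N).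
Proof.
move=> [Ms M0] [Ns N0]; split => [|x xn0]; first by rewrite linearD /= Ms Ns.
by rewrite quadfD ltr_pwDl ?M0.
Qed.

Lemma posdefZ n c (M : 'M[R]_n) : 0 < c -> posdefmx M -> posdefmx (c *: M).
Proof.
move=> c0 [Ms M0]; split => [|x x0]; first by rewrite linearZ /= Ms.
by rewrite quadfZ mulr_gt0 ?M0.
Qed.

Lemma posdef_unit n (M : 'M[R]_n) : posdefmx M -> M \in unitmx.
Proof.
move=> [Ms M0]; apply: unitmx_of_inj => x Mx; apply/eqP; apply: contraT => /M0.
by rewrite /quadf -mulmxA Mx mulmx0 mxE ltxx.
Qed.

Lemma posdef_inv n (M : 'M[R]_n) : posdefmx M -> posdefmx (invmx M).
Proof.
move=> Mpd; have Mu := posdef_unit Mpd; have [Ms M0] := Mpd.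
have iMs : (invmx M)^T = invmx M by rewrite trmx_inv Ms.
split=> // x x0.
have -> : invmx M = (invmx M)^T *m M *m invmx M by rewrite iMs mulVmx ?mul1mx.
rewrite quadf_congr; apply: M0; apply: contraNneq x0 => Mx.
by rewrite -(mulKVmx Mu x) Mx mulmx0.
Qed.

Lemma discriminant_le (a b c : R) : 0 <= a -> 0 <= c ->
  (forall t, 0 <= a + 2 * t * b + t ^+ 2 * c) -> b ^+ 2 <= a * c.
Proof.
move=> a0 c0 abc; have [c_eq0|cn0] := eqVneq c 0.
  have [->|bn0] := eqVneq b 0; first by rewrite c_eq0 expr0n mulr0.
  (* The polynomial is affine here, and this [t] gives it the value [-1]. *)
  have := abc (- (a + 1) / (2 * b)); rewrite c_eq0 mulr0 addr0.
  have -> : 2 * (- (a + 1) / (2 * b)) * b = - (a + 1) by field; rewrite bn0.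
  by lra.
have cp : 0 < c by rewrite lt_def cn0.
(* The minimiser of the quadratic. *)
have := abc (- b / c).
have -> : a + 2 * (- b / c) * b + (- b / c) ^+ 2 * c = (a * c - b ^+ 2) / c.
  by field.
by rewrite pmulr_lge0 ?invr_gt0// subr_ge0.
Qed.

Lemma psd_cauchy_schwarz n (M : 'M[R]_n) x y : psdmx M ->
  bilf M x y ^+ 2 <= quadf M x * quadf M y.
Proof.
move=> [Ms M0]; apply: discriminant_le => // t.
have := M0 (x + t *: y).
rewrite quadfE !(bilfDl, bilfDr, bilfZl, bilfZr) (bilfC y x Ms) -!quadfE.
by congr (_ <= _); ring.
Qed.

Lemma bilf_delta n (M : 'M[R]_n) i j :
  bilf M (delta_mx i 0) (delta_mx j 0) = M i j.
Proof. by rewrite /bilf trmx_delta -rowE -colE !mxE. Qed.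

Lemma bilf_deltal n (M : 'M[R]_n) i y : bilf M (delta_mx i 0) y = (M *m y) i 0.
Proof. by rewrite /bilf trmx_delta -mulmxA -rowE mxE. Qed.

(** Entry [i] of [M *m x] pairs [x] with a unit vector, so Cauchy-Schwarz bounds its square by
    [M i i * quadf M x]. The trace plays the role of the largest eigenvalue from here on. *)
Lemma psd_norm_mul n (M : 'M[R]_n) x : psdmx M ->
  quadf 1%:M (M *m x) <= \tr M * quadf M x.
Proof.
move=> Mp; rewrite quadf1 /mxtrace mulr_suml; apply: ler_sum => i _.
by rewrite -bilf_deltal -(bilf_delta M i i) -quadfE psd_cauchy_schwarz.
Qed.

Lemma psd_tr_ge0 n (M : 'M[R]_n) : psdmx M -> 0 <= \tr M.
Proof.
by move=> [_ M0]; apply: sumr_ge0 => i _; rewrite -bilf_delta -quadfE.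
Qed.

(** With [q = quadf M x], Cauchy-Schwarz for [x] and [M *m x] gives
    [q^2 <= |x|^2 |M x|^2 <= |x|^2 tr(M) q], and a positive [q] cancels. *)
Lemma psd_le_tr n (M : 'M[R]_n) x : psdmx M ->
  quadf M x <= \tr M * quadf 1%:M x.
Proof.
move=> Mp; have [_ M0] := Mp; have := M0 x; rewrite le_eqVlt => /orP[/eqP<-|q0].
  by rewrite mulr_ge0 ?psd_tr_ge0 ?quadf1_ge0.
rewrite -(ler_pM2l q0).
have := psd_cauchy_schwarz x (M *m x) (psdmx1 n).
have -> : bilf 1%:M x (M *m x) = quadf M x by rewrite /bilf mulmx1 mulmxA.
rewrite expr2 => /le_trans; apply.
apply: le_trans (ler_wpM2l (quadf1_ge0 x) (psd_norm_mul x Mp)) _.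
by rewrite le_eqVlt; apply/orP; left; apply/eqP; ring.
Qed.

Lemma psd_quadf0 n (M : 'M[R]_n) : psdmx M -> (forall x, quadf M x = 0) -> M = 0.
Proof.
move=> [Ms _] M0; apply/matrixP=> i j; rewrite mxE -bilf_delta.
have := M0 (delta_mx i 0 + delta_mx j 0).
rewrite quadfE !(bilfDl, bilfDr) -!quadfE !M0 (bilfC (delta_mx j 0) _ Ms).
by rewrite add0r addr0 => h; lra.
Qed.

Lemma psd_tr0 n (M : 'M[R]_n) : psdmx M -> \tr M <= 0 -> M = 0.
Proof.
move=> Mp trM; apply: psd_quadf0 => // x; apply/le_anti/andP; split; last first.
  by have [_] := Mp.
apply: le_trans (psd_le_tr x Mp) _.
by rewrite mulr_le0_ge0 ?quadf1_ge0.
Qed.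

(** Cauchy-Schwarz in the form [M] for [x] and [M^-1 x] gives [|x|^4 <= quadf M x * quadf M^-1 x],
    and the last factor is at most [tr(M^-1) |x|^2]. The constant is the inverse of [1 + t] because
    [t] is 0 when [n = 0]. *)
Lemma posdef_ge n (M : 'M[R]_n) : posdefmx M ->
  exists2 c, 0 < c & forall x, c * quadf 1%:M x <= quadf M x.
Proof.
move=> Mpd; have Mu := posdef_unit Mpd; have Mp := posdef_psd Mpd.
have iMp := posdef_psd (posdef_inv Mpd).
have t0 := psd_tr_ge0 iMp; set t := \tr (invmx M) in t0.
exists (1 + t)^-1 => [|x]; first by rewrite invr_gt0; lra.
rewrite ler_pdivrMl; last by lra.
have [_ /(_ x) q0] := Mp.
have := quadf1_ge0 x; rewrite le_eqVlt => /orP[/eqP<-|x0].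
  by rewrite mulr_ge0//; lra.
rewrite -(ler_pM2l x0).
have := psd_cauchy_schwarz x (invmx M *m x) Mp.
have -> : bilf M x (invmx M *m x) = quadf 1%:M x.
  by rewrite /bilf mulmxA mulmxK// /quadf mulmx1.
have -> : quadf M (invmx M *m x) = quadf (invmx M) x.
  by rewrite -quadf_congr (proj1 iMp) mulVmx ?mul1mx.
rewrite expr2 => /le_trans; apply.
apply: le_trans (ler_wpM2l q0 (psd_le_tr x iMp)) _.
rewrite -/t; nra.
Qed.

End QuadraticForms.

(** * Strict monotonicity of the trace of the inverse *)

Section InverseTrace.
Variable R : realType.

(* (P - Z)^-1 = P^-1 + P^-1 Z P^-1 + P^-1 Z (P - Z)^-1 Z P^-1 *)
Lemma tr_invmx_sub n (P Z : 'M[R]_n) : posdefmx P -> psdmx Z ->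
  posdefmx (P - Z) -> \tr (invmx (P - Z)) <= \tr (invmx P) -> Z = 0.
Proof.
move=> Pp Zp PZp trP.
have Pu := posdef_unit Pp; have PZu := posdef_unit PZp.
have [iPs _] := posdef_inv Pp; have [Zs _] := Zp.
set S := invmx P in iPs; set U := invmx (P - Z).
have UE : U = S + S *m Z *m U.
  rewrite -[LHS](mulKmx Pu) -/S -[X in S *m (X *m U)](subrK Z) mulmxDl.
  by rewrite mulmxV// mulmxDr mulmx1 mulmxA.
have UE' : U = S + U *m Z *m S.
  have := congr1 trmx UE; rewrite linearD /= !trmx_mul iPs Zs.
  by rewrite (proj1 (posdef_inv PZp)) mulmxA.
have UE2 : U = S + S^T *m Z *m S + (Z *m S)^T *m U *m (Z *m S).
  rewrite {1}UE {1}UE' mulmxDr addrA trmx_mul iPs Zs.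
  by rewrite !mulmxA.
have p1 : psdmx (S^T *m Z *m S) by exact: psdmx_congr.
have p2 : psdmx ((Z *m S)^T *m U *m (Z *m S)).
  by apply: psdmx_congr; apply: posdef_psd; exact: posdef_inv.
(* Both corrections to [S] in [UE2] are semidefinite, so [trP] leaves no room for the trace of the
   first one. *)
have S0 : S^T *m Z *m S = 0.
  apply: psd_tr0 => //; move: trP; rewrite -/U UE2 !linearD /=.
  by have := psd_tr_ge0 p2; rewrite -/S; lra.
have := congr1 (fun M => P *m M *m P) S0.
by rewrite iPs mulmx0 mul0mx !mulmxA mulmxV// mul1mx mulmxKV.
Qed.

End InverseTrace.

(** * The Cayley transform *)

Section Cayley.
Variables (R : realType) (n : nat) (A : 'M[R]_n).

(** If [A *m x = x], the Lyapunov form at [x] equals [2 * quadf P x]. A nonstrict inequality thus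
    already excludes the eigenvalue 1, where the Cayley transform is undefined. *)
Lemma lyapunov_unit (P : 'M[R]_n) : posdefmx P ->
  nsdmx (A^T *m P + P *m A) -> 1%:M - A \in unitmx.
Proof.
move=> Pp [_ AP]; apply: unitmx_of_inj => x.
rewrite mulmxBl mul1mx => /eqP; rewrite subr_eq0 => /eqP xA.
apply/eqP; apply: contraT => /(proj2 Pp).
have := AP x; rewrite quadfN quadfD.
have -> : quadf (A^T *m P) x = quadf P x.
  by rewrite /quadf mulmxA -trmx_mul -xA.
have -> : quadf (P *m A) x = quadf P x.
  by rewrite /quadf -!mulmxA -xA.
lra.
Qed.

(* Powers of the Cayley transform play the role of the flow exp(tA): Lyapunov
   expressions in A become Stein differences in cayley. *)
Definition cayley : 'M[R]_n := (1%:M + A) *m invmx (1%:M - A).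

Hypothesis Au : 1%:M - A \in unitmx.

(** After the congruence by [1 - A] this is [(1 + A)^T Z (1 + A) - (1 - A)^T Z (1 - A) = 2 (A^T Z +
    Z A)]. *)
Lemma cayley_stein (Z : 'M[R]_n) :
  cayley^T *m Z *m cayley - Z =
  2 *: ((invmx (1%:M - A))^T *m (A^T *m Z + Z *m A) *m invmx (1%:M - A)).
Proof.
set E := invmx _.
have ZE : Z = E^T *m ((1%:M - A)^T *m Z *m (1%:M - A)) *m E.
  rewrite !mulmxA -trmx_mul mulmxV// trmx1 mul1mx -mulmxA mulmxV//.
  by rewrite mulmx1.
have -> : cayley^T *m Z *m cayley = E^T *m ((1%:M + A)^T *m Z *m (1%:M + A)) *m E.
  by rewrite /cayley trmx_mul !mulmxA.
rewrite [X in _ - X]ZE -mulmxBl -mulmxBr [RHS]scalemxAl [X in _ = X *m E]scalemxAr.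
congr (_ *m _ *m _).
by mxexpand; mxabel.
Qed.

Lemma cayley_congr (Z : 'M[R]_n) :
  A^T *m Z + Z *m A =
  2^-1 *: ((1%:M - A)^T *m (cayley^T *m Z *m cayley - Z) *m (1%:M - A)).
Proof.
rewrite cayley_stein -scalemxAr -scalemxAl scalerA mulVf ?pnatr_eq0// scale1r.
rewrite !mulmxA -trmx_mul mulVmx// trmx1 mul1mx -mulmxA mulVmx//.
by rewrite mulmx1.
Qed.

End Cayley.

(** * Entrywise limits of matrices *)

Section MonotoneLimit.
Variable R : realType.

Lemma cvg_sumr T (F : set_system T) (FF : Filter F) I (r : seq I) (P : pred I)
    (h : I -> T -> R) (a : I -> R) :
  (forall i, P i -> h i x @[x --> F] --> a i) ->
  \sum_(i <- r | P i) h i x @[x --> F] --> \sum_(i <- r | P i) a i.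
Proof. by move=> ha; apply: cvg_big => //; exact: add_continuous. Qed.

Section MatrixCvg.
Variables (T : Type) (F : set_system T).

(** The filter is arbitrary, so that one notion serves matrix sequences and trajectories. *)
Definition mcvg p q (Z : T -> 'M[R]_(p, q)) (L : 'M[R]_(p, q)) :=
  forall i j, Z k i j @[k --> F] --> L i j.

Hypothesis FF : Filter F.

Lemma mcvg_cst p q (C : 'M[R]_(p, q)) : mcvg (fun=> C) C.
Proof. by move=> i j; exact: cvg_cst. Qed.

Lemma mcvgD p q (Z Z' : T -> 'M[R]_(p, q)) L L' :
  mcvg Z L -> mcvg Z' L' -> mcvg (fun k => Z k + Z' k) (L + L').
Proof.
move=> ZL ZL' i j; rewrite addmxE.
by under eq_fun do rewrite addmxE; apply: cvgD.
Qed.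

Lemma mcvgZ p q c (Z : T -> 'M[R]_(p, q)) L :
  mcvg Z L -> mcvg (fun k => c *: Z k) (c *: L).
Proof.
move=> ZL i j; rewrite scalemxE.
by under eq_fun do rewrite scalemxE; apply: cvgM => //; exact: cvg_cst.
Qed.

Lemma mcvg_tr p q (Z : T -> 'M[R]_(p, q)) L :
  mcvg Z L -> mcvg (fun k => (Z k)^T) L^T.
Proof. by move=> ZL i j; rewrite mxE; under eq_fun do rewrite mxE; exact: ZL. Qed.

Lemma mcvgM p q r (Z : T -> 'M[R]_(p, q)) (Z' : T -> 'M[R]_(q, r)) L L' :
  mcvg Z L -> mcvg Z' L' -> mcvg (fun k => Z k *m Z' k) (L *m L').
Proof.
move=> ZL ZL' i j; rewrite mxE; under eq_fun do rewrite mxE.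
by apply: cvg_sumr => k _; apply: cvgM.
Qed.

Lemma mcvg_quadf n (Z : T -> 'M[R]_n) (x : T -> 'cV[R]_n) L l :
  mcvg Z L -> mcvg x l -> quadf (Z k) (x k) @[k --> F] --> quadf L l.
Proof. by move=> ZL xl; exact: (mcvgM (mcvgM (mcvg_tr xl) ZL) xl). Qed.

End MatrixCvg.

Lemma mcvg_shift p q (Z : nat -> 'M[R]_(p, q)) L :
  mcvg \oo Z L -> mcvg \oo (fun k => Z k.+1) L.
Proof. by move=> ZL i j; rewrite (cvg_shiftS (fun k => Z k i j)). Qed.

Lemma mcvg_unique p q (Z : nat -> 'M[R]_(p, q)) L L' :
  mcvg \oo Z L -> mcvg \oo Z L' -> L = L'.
Proof.
move=> ZL ZL'; apply/matrixP=> i j.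
by apply: (cvg_unique _ (ZL i j) (ZL' i j)); exact: Rhausdorff.
Qed.

Lemma mcvg_psd n (Z : nat -> 'M[R]_n) L :
  (forall k, psdmx (Z k)) -> mcvg \oo Z L -> psdmx L.
Proof.
move=> Zp ZL; split=> [|x].
  apply: (mcvg_unique _ ZL) => i j; rewrite mxE.
  by under eq_fun do rewrite -(proj1 (Zp _)) mxE; exact: ZL.
have Zx : quadf (Z k) x @[k --> \oo] --> quadf L x.
  exact: (mcvg_quadf _ ZL (@mcvg_cst _ _ _ _ _ x)).
apply: (cvgr_to_ge Zx).
by near=> k; have [_] := Zp k.
Unshelve. all: by end_near. Qed.

(* The quadratic forms converge by monotonicity, the entries by polarization. *)
Lemma psd_decreasing_cvg n (Z : nat -> 'M[R]_n) :
  (forall k, psdmx (Z k)) -> (forall k, psdmx (Z k - Z k.+1)) ->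
  exists L, mcvg \oo Z L.
Proof.
move=> Zp Zd.
have qcvg x : cvgn (fun k => quadf (Z k) x).
  apply: nonincreasing_is_cvgn.
    apply/nonincreasing_seqP => k; rewrite -subr_ge0 -quadfB.
    by have [_] := Zd k.
  by exists 0 => _ [k _ <-]; have [_] := Zp k.
suff ecvg i j : cvgn (fun k => Z k i j).
  exists (\matrix_(i, j) limn (fun k => Z k i j)) => i j.
  by rewrite mxE; exact: ecvg.
pose e i : 'cV[R]_n := delta_mx i 0.
have -> : (fun k => Z k i j) = (fun k => 2^-1 *
    (quadf (Z k) (e i + e j) - quadf (Z k) (e i) - quadf (Z k) (e j))).
  apply/funext => k.
  rewrite [in RHS]quadfE !(bilfDl, bilfDr) -!quadfE.
  by rewrite (bilfC (e j) _ (proj1 (Zp k))) bilf_delta; field.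
apply: is_cvgM; first exact: is_cvg_cst.
by apply: is_cvgB => //; apply: is_cvgB.
Qed.

End MonotoneLimit.

(** * Consequences of maximality for the Riccati inequality *)

Section MaximalSolution.
Variables (R : realType) (n m : nat).
Variables (A : 'M[R]_n) (B : 'M[R]_(n, m)) (Q : 'M[R]_n) (Rw : 'M[R]_m).
Hypotheses (Qp : psdmx Q) (Rp : psdmx Rw).

Definition ric (P : 'M[R]_n) (K : 'M[R]_(m, n)) : 'M[R]_n :=
  (A + B *m K)^T *m P + P *m (A + B *m K) + Q + K^T *m Rw *m K.

Definition ric_maximal (P : 'M[R]_n) (K : 'M[R]_(m, n)) : Prop :=
  [/\ posdefmx P, nsdmx (ric P K) & forall P' K', posdefmx P' ->
      nsdmx (ric P' K') -> \tr (invmx P') <= \tr (invmx P)].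

Lemma ric_subl P Z K : ric (P - Z) K =
  ric P K - ((A + B *m K)^T *m Z + Z *m (A + B *m K)).
Proof. by rewrite /ric mulmxBr mulmxBl; mxabel. Qed.

Lemma ric_addr P K V : ric P (K + V) = ric P K + V^T *m (B^T *m P + Rw *m K)
  + (P *m B + K^T *m Rw) *m V + V^T *m Rw *m V.
Proof. by rewrite /ric; mxexpand; mxabel. Qed.

Section Fixed.
Variables (P : 'M[R]_n) (K : 'M[R]_(m, n)).
Hypothesis PK : ric_maximal P K.

(** [Ac] is the closed-loop matrix, [M] the weight of the running cost, [H] the slack in the
    inequality. *)
Let Ac := A + B *m K.
Let M := Q + K^T *m Rw *m K.
Let H := - ric P K.

Let Pp : posdefmx P. Proof. by have [] := PK. Qed.
Let Hp : psdmx H. Proof. by have [] := PK. Qed.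
Let Mp : psdmx M. Proof. by apply: psdmxD => //; exact: psdmx_congr. Qed.

Let lyapE : Ac^T *m P + P *m Ac = - (M + H).
Proof. by rewrite /H /ric /M -/Ac; mxabel. Qed.

Let lyap_nsd : nsdmx (Ac^T *m P + P *m Ac).
Proof. by rewrite lyapE /nsdmx opprK; exact: psdmxD. Qed.

Let Au : 1%:M - Ac \in unitmx.
Proof. exact: lyapunov_unit Pp lyap_nsd. Qed.

Let E := invmx (1%:M - Ac).
Let C := cayley Ac.

(** With [K] kept, passing from [P] to [P - Z] changes the slack to the matrix in the last
    hypothesis; maximality then bounds the trace of the new inverse, and strict monotonicity gives
    [Z = 0]. *)
Lemma ric_maximal_sub (Z : 'M[R]_n) : psdmx Z -> posdefmx (P - Z) ->
  psdmx (H + (Ac^T *m Z + Z *m Ac)) -> Z = 0.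
Proof.
move=> Zp PZp HZ; have [_ _ Pmax] := PK.
apply: (tr_invmx_sub Pp Zp PZp); apply: (Pmax _ K) => //.
rewrite /nsdmx (_ : - _ = H + (Ac^T *m Z + Z *m Ac)) //.
by rewrite /H ric_subl -/Ac; mxabel.
Qed.

(* Otherwise Z := 2 E^T H E is nonzero and P - Z / 2 is still admissible, since
   A^T Z + Z A >= - H and P - Z = C^T P C + 2 E^T M E >= 0. *)
Lemma ric_maximal_eq0 : ric P K = 0.
Proof.
pose Z := 2 *: (E^T *m H *m E).
have Zp : psdmx Z by apply: psdmxZ => //; exact: psdmx_congr.
have ZH : (1%:M - Ac)^T *m Z *m (1%:M - Ac) = 2 *: H.
  rewrite /Z -scalemxAr -scalemxAl !mulmxA -trmx_mul mulVmx//.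
  by rewrite trmx1 mul1mx -mulmxA mulVmx// mulmx1.
have PZ : P - Z = C^T *m P *m C + 2 *: (E^T *m M *m E).
  have := cayley_stein Au P; rewrite -/C -/E lyapE => /eqP.
  rewrite subr_eq => /eqP ->.
  by rewrite /Z (mulmxN _ (M + H)) mulNmx (mulmxDr _ M H) mulmxDl; mxabel.
have Z0 : 2^-1 *: Z = 0.
  apply: ric_maximal_sub.
  - by apply: psdmxZ => //; rewrite invr_ge0.
  - have -> : P - 2^-1 *: Z = 2^-1 *: P + 2^-1 *: (P - Z).
      by apply/matrixP=> i j; rewrite ?(addmxE, oppmxE, scalemxE); field.
    apply: posdefDl; first by apply: posdefZ => //; rewrite invr_gt0.
    rewrite PZ; apply: psdmxZ; first by rewrite invr_ge0.
    apply: psdmxD; first by apply: psdmx_congr; exact: posdef_psd.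
    by apply: psdmxZ => //; exact: psdmx_congr.
  - rewrite -scalemxAr -scalemxAl -scalerDr (cayley_congr Au) -/C.
    rewrite (mulmxBr _ _ Z) (mulmxBl _ _ (1%:M - Ac)) ZH.
    set S := (1%:M - Ac)^T *m (C^T *m Z *m C) *m (1%:M - Ac).
    have -> : H + 2^-1 *: (2^-1 *: (S - 2 *: H)) = 4^-1 *: S + 2^-1 *: H.
      by apply/matrixP=> i j; rewrite ?(addmxE, oppmxE, scalemxE); field.
    apply: psdmxD; apply: psdmxZ => //; rewrite ?invr_ge0//.
    by apply: psdmx_congr; exact: psdmx_congr.
have {}Z0 : Z = 0.
  by apply: (scalerI (a := 2^-1)); rewrite ?scaler0// invr_eq0 pnatr_eq0.
move: ZH; rewrite Z0 mulmx0 mul0mx => /esym/eqP.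
by rewrite scaler_eq0 pnatr_eq0 /= oppr_eq0 => /eqP.
Qed.

(** [(C^k)^T P C^k], the Lyapunov function after [k] Cayley steps. It decreases because the Stein
    difference of [P] is [-2 E^T (M + H) E]. *)
Let Zs (k : nat) : 'M[R]_n := iter k (fun Z => C^T *m Z *m C) P.

Let Zs_psd k : psdmx (Zs k).
Proof. by elim: k => [|k IH]; [exact: posdef_psd|exact: psdmx_congr]. Qed.

Let Zs_decr k : psdmx (Zs k - Zs k.+1).
Proof.
elim: k => [|k IH] /=.
  rewrite -opprB (cayley_stein Au) lyapE mulmxN mulNmx scalerN opprK.
  by apply: psdmxZ => //; apply: psdmx_congr; exact: psdmxD.
by rewrite -mulmxBl -mulmxBr; exact: psdmx_congr.
Qed.

(* The limit L satisfies C^T L C = L, that is, A^T L + L A = 0, so P - L / 2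
   would be an improvement unless L = 0. *)
Let Zs_cvg0 : mcvg \oo Zs 0.
Proof.
have [L ZL] := psd_decreasing_cvg Zs_psd Zs_decr.
suff <- : L = 0 by [].
have CL : C^T *m L *m C = L.
  apply: (mcvg_unique _ (mcvg_shift ZL)).
  exact: (mcvgM _ (mcvgM _ (@mcvg_cst _ _ _ _ _ _ C^T) ZL) (@mcvg_cst _ _ _ _ _ _ C)).
have Lp : psdmx L by exact: mcvg_psd ZL.
have PL : psdmx (P - L).
  apply: (@mcvg_psd _ _ (fun k => P + (-1) *: Zs k)) => [k|]; last first.
    by rewrite -(scaleN1r L); exact: (mcvgD _ (@mcvg_cst _ _ _ _ _ _ P) (mcvgZ _ ZL)).
  rewrite scaleN1r; elim: k => [|k IH]; first by rewrite subrr; exact: psdmx0.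
  by rewrite -(subrKA (Zs k)); exact: psdmxD.
have L0 : 2^-1 *: L = 0.
  apply: ric_maximal_sub.
  - by apply: psdmxZ => //; rewrite invr_ge0.
  - have -> : P - 2^-1 *: L = 2^-1 *: P + 2^-1 *: (P - L).
      by apply/matrixP=> i j; rewrite ?(addmxE, oppmxE, scalemxE); field.
    apply: posdefDl; first by apply: posdefZ => //; rewrite invr_gt0.
    by apply: psdmxZ => //; rewrite invr_ge0.
  - rewrite -scalemxAr -scalemxAl -scalerDr (cayley_congr Au) -/C CL subrr.
    by rewrite mulmx0 mul0mx !scaler0 addr0.
by apply: (scalerI (a := 2^-1)); rewrite ?scaler0// invr_eq0 pnatr_eq0.
Qed.

(* X := Zs 0 + ... + Zs k with Zs k.+1 <= P / 2, so that C^T X C - X <= - P / 2. *)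
Lemma ric_maximal_stable : exists X d, [/\ posdefmx X, 0 < d &
  forall x, quadf (Ac^T *m X + X *m Ac) x <= - d * quadf X x].
Proof.
have [c c0 cP] := posdef_ge Pp.
have trZ : \tr (Zs k.+1) @[k --> \oo] --> (0 : R).
  rewrite (_ : 0 = \sum_(i < n) (0 : 'M[R]_n) i i); last first.
    by rewrite big1// => i _; rewrite mxE.
  by apply: cvg_sumr => i _; exact: (mcvg_shift Zs_cvg0).
(* Since [c] bounds [P] below, the trace bound [c / 2] yields [Zs k.+1 <= P / 2]. *)
have [k Zk] : exists k, \tr (Zs k.+1) <= c / 2.
  have [k _ kP] : \forall k \near \oo, \tr (Zs k.+1) < c / 2.
    by apply: cvgr_lt trZ _ _; rewrite divr_gt0.
  by exists k; apply/ltW/kP => /=.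
pose X := \sum_(j < k.+1) Zs j.
(* The sum telescopes, each congruence by [C] shifting the index by one. *)
have XC : C^T *m X *m C - X = Zs k.+1 - P.
  rewrite /X mulmx_sumr mulmx_suml.
  rewrite (eq_bigr (fun j : 'I_k.+1 => Zs j.+1)) //.
  rewrite big_ord_recr [X in _ - X]big_ord_recl /= opprD [- _ - _]addrC.
  by rewrite addrACA subrr add0r.
have Xp : posdefmx X.
  rewrite /X big_ord_recl; apply: posdefDl => //.
  by elim/big_ind : _ => [||i _]; [exact: psdmx0|exact: psdmxD|exact: Zs_psd].
pose S := (1%:M - Ac)^T *m P *m (1%:M - Ac).
have Sp : posdefmx S.
  split=> [|x x0]; first by rewrite !trmx_mul trmxK (proj1 Pp) mulmxA.
  rewrite quadf_congr; apply: (proj2 Pp); apply: contraNneq x0 => Ax.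
  by rewrite -(mulKmx Au x) Ax mulmx0.
have [s s0 sS] := posdef_ge Sp.
have trX := psd_tr_ge0 (posdef_psd Xp).
(* One half comes from [cayley_congr] and one from [q1]; [s] bounds [S] below and [1 + \tr X] bounds
   [X] above by multiples of the identity. *)
exists X, (4^-1 * s / (1 + \tr X)); split=> // [|x].
  by rewrite divr_gt0 ?mulr_gt0 ?invr_gt0//; lra.
rewrite (cayley_congr Au) -/C XC quadfZ quadf_congr quadfB.
set y := _ *m x.
have q1 : quadf (Zs k.+1) y <= 2^-1 * quadf P y.
  apply: le_trans (psd_le_tr y (Zs_psd k.+1)) _.
  apply: le_trans (ler_wpM2r (quadf1_ge0 y) Zk) _.
  by rewrite mulrAC mulrC ler_wpM2l ?invr_ge0.
have q2 : s * quadf 1%:M x <= quadf P y by rewrite -quadf_congr; exact: sS.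
have q3 : quadf X x / (1 + \tr X) <= quadf 1%:M x.
  rewrite ler_pdivrMr; last by lra.
  apply: le_trans (psd_le_tr x (posdef_psd Xp)) _.
  by rewrite mulrC ler_wpM2l ?quadf1_ge0//; lra.
have q4 := ler_wpM2l (ltW s0) q3.
rewrite (_ : - _ * _ = - (4^-1 * (s * (quadf X x / (1 + \tr X))))); last ring.
lra.
Qed.

End Fixed.

(* K - e G has a smaller residual by about 2 e G^T G; the pair it forms with P
   is again maximal, hence has residual 0 as well. *)
Lemma ric_maximal_gain (P : 'M[R]_n) (K : 'M[R]_(m, n)) :
  ric_maximal P K -> B^T *m P + Rw *m K = 0.
Proof.
move=> PK; have PK0 := ric_maximal_eq0 PK; have [Pp _ Pmax] := PK.
set G := B^T *m P + Rw *m K.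
have trR := psd_tr_ge0 Rp.
(* Small enough that [e *: Rw] stays below the identity: the second-order term [e^2 G^T Rw G] then
   takes up at most half of [2 e G^T G]. *)
pose e := (1 + \tr Rw)^-1.
have e0 : 0 < e by rewrite invr_gt0; lra.
have ricE : ric P (K - e *: G) = - ((2 * e) *: (G^T *m G)
    - (e ^+ 2) *: (G^T *m Rw *m G)).
  have PB : P *m B + K^T *m Rw = G^T.
    by rewrite /G linearD /= !trmx_mul trmxK (proj1 Pp) (proj1 Rp).
  rewrite ric_addr PB PK0 -/G linearN linearZ /= !mulmxN !mulNmx.
  by rewrite -?scalemxAl -?scalemxAr -?scalemxAl; mxabel.
have GG0 : psdmx ((2 * e) *: (G^T *m G) - e ^+ 2 *: (G^T *m Rw *m G) - e *: (G^T *m G)).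
  split=> [|x].
    by mxexpand; rewrite (proj1 Rp).
  have -> : G^T *m G = G^T *m 1%:M *m G by rewrite mulmx1.
  rewrite !(quadfB, quadfZ) !quadf_congr.
  have q1 := psd_le_tr (G *m x) Rp; have q2 := quadf1_ge0 (G *m x).
  have q3 : e ^+ 2 * quadf Rw (G *m x) <= e * quadf 1%:M (G *m x).
    rewrite expr2 -mulrA ler_wpM2l ?(ltW e0)// ler_pdivrMl; last by lra.
    by apply: le_trans q1 _; nra.
  lra.
have PG : ric_maximal P (K - e *: G).
  split=> //; rewrite ricE /nsdmx opprK.
  rewrite -[X in psdmx X](subrK (e *: (G^T *m G))).
  by apply: psdmxD => //; apply: psdmxZ (ltW e0) (psdmx_gram _).
(* The new residual vanishes too, so the matrix in [GG0] reduces to [- e *: (G^T *m G)]; its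
   semidefiniteness forces [G = 0]. *)
have := ric_maximal_eq0 PG; rewrite ricE => /eqP; rewrite oppr_eq0 => /eqP GG1.
move: GG0; rewrite GG1 sub0r => -[_ GG].
apply: trmx_inj; apply/matrixP => i j; rewrite trmx0 [RHS]mxE mxE.
suff : G *m delta_mx i (0 : 'I_1) = 0.
  by rewrite -colE => /matrixP/(_ j 0); rewrite !mxE.
apply: quadf1_eq0; apply/le_anti; rewrite quadf1_ge0 andbT.
have := GG (delta_mx i 0); rewrite quadfN quadfZ -{1}[G^T]mulmx1 quadf_congr.
by rewrite oppr_ge0 pmulr_rle0.
Qed.

(** Completion of the square in [u]: the Riccati equation settles [u = K x], and [B^T P = - Rw K]
    supplies the cross terms. The summand with factor 2 is the derivative of [x^T P x] along the
    dynamics. *)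
Lemma ric_maximal_dissipation (P : 'M[R]_n) (K : 'M[R]_(m, n)) x u :
  ric_maximal P K ->
  quadf Q x + quadf Rw u + 2 * bilf P x (A *m x + B *m u) =
  quadf Rw (u - K *m x).
Proof.
move=> PK; have PK0 := ric_maximal_eq0 PK; have G0 := ric_maximal_gain PK.
have [[Ps _] _ _] := PK; have [Rs _] := Rp.
have := congr1 (fun X => quadf X x) PK0; rewrite quadf0.
rewrite /ric !quadfD.
have -> : quadf ((A + B *m K)^T *m P) x = bilf P (A *m x + B *m (K *m x)) x.
  by rewrite /quadf /bilf mulmxA -trmx_mul mulmxDl !mulmxA.
have -> : quadf (P *m (A + B *m K)) x = bilf P x (A *m x + B *m (K *m x)).
  by rewrite /quadf /bilf -!mulmxA mulmxDl !mulmxA.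
rewrite (bilfC _ x Ps) quadf_congr.
have BR y : bilf P x (B *m y) = - bilf Rw (K *m x) y.
  have : (B^T *m P + Rw *m K)^T = 0 by rewrite G0 trmx0.
  rewrite linearD /= !trmx_mul trmxK Ps Rs => /eqP; rewrite addr_eq0 => /eqP PB.
  by rewrite /bilf !mulmxA -(mulmxA x^T) PB mulmxN mulNmx oppmxE trmx_mul !mulmxA.
rewrite !bilfDr !BR [quadf Rw (u - _)]quadfE -(scaleN1r (K *m x)).
rewrite !(bilfDl, bilfDr, bilfZl, bilfZr) (bilfC u _ Rs) -!quadfE.
lra.
Qed.

End MaximalSolution.

(** * Existence of semidefinite square roots *)

Section SquareRoot.
Variable R : realType.

Section NonnegativePolynomials.
Variables (n : nat) (T : 'M[R]_n).

(** Values at [T] of polynomials with nonnegative coefficients. Unlike semidefinite matrices at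
    large, they commute and are closed under products. *)
Inductive nnpoly : 'M[R]_n -> Prop :=
| nnpoly0 : nnpoly 0
| nnpolyX k : nnpoly (iter k (mulmx T) 1%:M)
| nnpolyD a b : nnpoly a -> nnpoly b -> nnpoly (a + b)
| nnpolyZ c a : 0 <= c -> nnpoly a -> nnpoly (c *: a).

Lemma iter_mulmxD j k : iter j (mulmx T) 1%:M *m iter k (mulmx T) 1%:M =
  iter (j + k) (mulmx T) 1%:M.
Proof. by elim: j => [|j IH]; rewrite ?mul1mx//= -mulmxA IH. Qed.

Lemma nnpolyM a b : nnpoly a -> nnpoly b -> nnpoly (a *m b).
Proof.
elim=> [|j|a1 a2 _ ha1 _ ha2 hb|c a' c0 _ ha hb] => [_|hb||].
- by rewrite mul0mx; exact: nnpoly0.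
- elim: hb => [|k|b1 b2 _ hb1 _ hb2|c b' c0 _ hb].
  + by rewrite mulmx0; exact: nnpoly0.
  + by rewrite iter_mulmxD; exact: nnpolyX.
  + by rewrite mulmxDr; exact: nnpolyD.
  + by rewrite -scalemxAr; exact: nnpolyZ.
- by rewrite mulmxDl; apply: nnpolyD; [exact: ha1|exact: ha2].
- by rewrite -scalemxAl; apply: nnpolyZ => //; exact: ha.
Qed.

Lemma nnpolyC a b : nnpoly a -> nnpoly b -> a *m b = b *m a.
Proof.
elim=> [|j|a1 a2 _ ha1 _ ha2 hb|c a' c0 _ ha hb] => [_|hb||].
- by rewrite mul0mx mulmx0.
- elim: hb => [|k|b1 b2 _ hb1 _ hb2|c b' c0 _ hb].
  + by rewrite mulmx0 mul0mx.
  + by rewrite !iter_mulmxD addnC.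
  + by rewrite mulmxDr hb1 hb2 mulmxDl.
  + by rewrite -scalemxAr hb scalemxAl.
- by rewrite mulmxDl ha1// ha2// mulmxDr.
- by rewrite -scalemxAl ha// scalemxAr.
Qed.

Hypothesis Tp : psdmx T.

(** For powers, [T^(k+2) = T T^k T] is a congruence, hence the induction on two consecutive
    exponents. *)
Lemma nnpoly_psd a : nnpoly a -> psdmx a.
Proof.
elim=> [|k|a1 a2 _ ha1 _ ha2|c a' c0 _ ha].
- exact: psdmx0.
- have TC j : iter j (mulmx T) 1%:M *m T = iter j.+1 (mulmx T) 1%:M.
    by have := iter_mulmxD j 1; rewrite /= mulmx1 addn1.
  suff : psdmx (iter k (mulmx T) 1%:M) /\ psdmx (iter k.+1 (mulmx T) 1%:M).
    by case.
  elim: k => [|k [IH1 IH2]]; first by rewrite /= mulmx1; split=> //; exact: psdmx1.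
  split=> //=; rewrite -/(iter k.+1 (mulmx T) 1%:M) -TC mulmxA -{1}(proj1 Tp).
  exact: psdmx_congr.
- exact: psdmxD.
- exact: psdmxZ.
Qed.

End NonnegativePolynomials.

(* The iteration y := (T + y^2) / 2 for T = 1 - X (Riesz and Sz.-Nagy): its
   increments are polynomials in T with nonnegative coefficients, and it stays
   below 1, so it converges to 1 - sqrt X. *)
Lemma psd_sqrt_le1 n (X : 'M[R]_n) : psdmx X -> psdmx (1%:M - X) ->
  exists2 S : 'M[R]_n, psdmx S & S *m S = X.
Proof.
move=> Xp Tp; set T := 1%:M - X in Tp.
pose y := fix y k := if k is k'.+1 then 2^-1 *: (T + y k' *m y k') else 0 : 'M[R]_n.
have h2 : 0 <= 2^-1 :> R by rewrite invr_ge0.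
have nnT : nnpoly T T by have := nnpolyX T 1; rewrite /= mulmx1.
have yn k : nnpoly T (y k).
  elim: k => [|k IH]; first exact: nnpoly0.
  by apply: nnpolyZ => //; apply: nnpolyD => //; exact: nnpolyM.
have dn k : nnpoly T (y k.+1 - y k).
  elim: k => [|k IH].
    by rewrite subr0 /= mulmx0 addr0; exact: nnpolyZ.
  (* The difference of squares factors because the iterates commute. *)
  rewrite (_ : _ - _ = 2^-1 *: ((y k.+1 - y k) *m (y k.+1 + y k))).
    by apply: nnpolyZ => //; apply: nnpolyM => //; exact: nnpolyD.
  rewrite [y k.+2]/(2^-1 *: (T + y k.+1 *m y k.+1)).
  rewrite [X in _ - X]/(2^-1 *: (T + y k *m y k)).
  set a := y k.+1; set b := y k.
  rewrite mulmxBl !mulmxDr (nnpolyC (yn k.+1) (yn k)) -/a -/b.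
  by mxabel.
have y1 k : psdmx (1%:M - y k).
  elim: k => [|k IH]; first by rewrite subr0; exact: psdmx1.
  have yp := nnpoly_psd Tp (yn k); set a := y k in IH yp.
  (* The term [a - a^2] is split into [a (1 - a) a + (1 - a) a (1 - a)], two congruences of
     semidefinite matrices. *)
  have -> : 1%:M - y k.+1 = 2^-1 *: (X + ((1%:M - a) +
      (a^T *m (1%:M - a) *m a + (1%:M - a)^T *m a *m (1%:M - a)))).
    rewrite (proj1 IH) (proj1 yp) /= -/a /T.
    have ->: a *m (1%:M - a) *m a + (1%:M - a) *m a *m (1%:M - a) = a - a *m a.
      by mxexpand; mxabel.
    by apply/matrixP=> i j; rewrite ?(addmxE, oppmxE, scalemxE); field.
  apply: psdmxZ => //; apply: psdmxD => //; apply: psdmxD => //.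
  by apply: psdmxD; exact: psdmx_congr.
have [|L yL] := psd_decreasing_cvg y1.
  move=> k; apply: (nnpoly_psd Tp).
  by rewrite opprB addrC addrA subrK.
exists L; first exact: mcvg_psd yL.
have yL1 : mcvg \oo y (1%:M - L).
  have -> : y = fun k => 1%:M + (-1) *: (1%:M - y k).
    by apply/funext => k; rewrite scaleN1r opprB addrC subrK.
  by rewrite -(scaleN1r L); exact: (mcvgD _ (@mcvg_cst _ _ _ _ _ _ 1%:M) (mcvgZ _ yL)).
(* The fixed-point equation of the iteration, which rearranges to [L *m L = X]. *)
have : 1%:M - L = 2^-1 *: (T + (1%:M - L) *m (1%:M - L)).
  apply: (mcvg_unique (mcvg_shift yL1)).
  exact: (mcvgZ _ (mcvgD _ (@mcvg_cst _ _ _ _ _ _ T) (mcvgM _ yL1 yL1))).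
mxexpand; rewrite /T => /matrixP eqL; apply/matrixP=> i j; move: (eqL i j).
by rewrite ?(addmxE, oppmxE, scalemxE); lra.
Qed.

Lemma psd_sqrt n (X : 'M[R]_n) : psdmx X ->
  exists2 S : 'M[R]_n, psdmx S & S *m S = X.
Proof.
move=> Xp; have tX := psd_tr_ge0 Xp.
have c0 : 0 < 1 + \tr X by lra.
have [||S Sp SS] := @psd_sqrt_le1 n ((1 + \tr X)^-1 *: X).
- by apply: psdmxZ => //; rewrite invr_ge0 ltW.
- split=> [|x]; first by rewrite linearB linearZ /= trmx1 (proj1 Xp).
  rewrite quadfB quadfZ subr_ge0 ler_pdivrMl//.
  by apply: le_trans (psd_le_tr x Xp) _; have := quadf1_ge0 x; nra.
exists (Num.sqrt (1 + \tr X) *: S); first by apply: psdmxZ; rewrite ?sqrtr_ge0.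
rewrite -scalemxAr -scalemxAl SS !scalerA -expr2 sqr_sqrtr ?ltW//.
by rewrite mulfV ?gt_eqF// scale1r.
Qed.

(** As a root exists, [xget] does not return its default. *)
Lemma sqrtmxP n (X : 'M[R]_n) : psdmx X ->
  psdmx (sqrtmx X) /\ sqrtmx X *m sqrtmx X = X.
Proof.
move=> /psd_sqrt[S Sp SS].
apply: (@xgetPex _ 0 [set S : 'M[R]_n | psdmx S /\ S *m S = X]).
by exists S.
Qed.

End SquareRoot.

(** * Schur complement *)

Section Schur.
Variable R : realType.

(** Completing squares: the blocks [- 1%:M] make the negated form the negated Schur complement at
    [x] plus the squares of [y - U^T x] and [z - V^T x], which are made zero in one direction and
    dropped in the other. *)
Lemma nsd_schur n m (M1 U : 'M[R]_n) (V : 'M[R]_(n, m)) :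
  nsdmx (block_mx M1 (row_mx U V) (col_mx U^T V^T)
           (block_mx (- 1%:M) 0 0 (- 1%:M))) <->
  nsdmx (M1 + U *m U^T + V *m V^T).
Proof.
have quadE (x y : 'cV[R]_n) (z : 'cV[R]_m) :
    quadf (- block_mx M1 (row_mx U V) (col_mx U^T V^T)
           (block_mx (- 1%:M) 0 0 (- 1%:M))) (col_mx x (col_mx y z)) =
    quadf (- (M1 + U *m U^T + V *m V^T)) x
    + quadf 1%:M (y - U^T *m x) + quadf 1%:M (z - V^T *m x).
  rewrite /quadf -!mx00D.
  apply: (congr1 (fun M : 'M[R]_1 => M 0 0)).
  rewrite !(opp_block_mx, opp_row_mx, opp_col_mx, tr_col_mx).
  rewrite !(mul_row_block, mul_row_col, mul_mx_row, mul_row_col, mul_col_mx, mul_block_col, opprK).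
  rewrite add_row_mx mul_row_col ?oppr0 ?mulmx0 ?addr0 ?add0r.
  by mxexpand; mxabel.
have blk_tr : (block_mx M1 (row_mx U V) (col_mx U^T V^T)
      (block_mx (- 1%:M) 0 0 (- 1%:M)))^T =
    block_mx M1^T (row_mx U V) (col_mx U^T V^T)
      (block_mx (- 1%:M) 0 0 (- 1%:M)).
  rewrite !tr_block_mx tr_row_mx tr_col_mx !trmxK !linearN /= !trmx1.
  by rewrite !trmx0.
split=> -[Ms M0]; split=> [|x].
- move: Ms; rewrite linearN /= blk_tr => /eqP.
  rewrite eqr_opp => /eqP/eq_block_mx[M1s _ _ _].
  by rewrite !(linearN, linearD) /= !trmx_mul !trmxK M1s.
- have := M0 (col_mx x (col_mx (U^T *m x) (V^T *m x))).
  by rewrite quadE !subrr !quadf_0r !addr0.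
- rewrite linearN /= blk_tr; congr (- block_mx _ _ _ _).
  move: Ms; rewrite trmxN !trmxD !trmx_mul !trmxK => /eqP.
  by rewrite eqr_opp => /eqP/addIr/addIr.
- rewrite -(vsubmxK x) -(vsubmxK (dsubmx x)) quadE.
  by rewrite !addr_ge0 ?quadf1_ge0.
Qed.

End Schur.

(** * Quadratic forms along linear trajectories *)

Section Trajectory.
Variables (R : realType) (n : nat) (G : 'M[R]_n) (x : R -> 'cV[R]_n).
Hypothesis xc : forall k, {within `[0, +oo[, continuous (fun t : R => x t k 0)}.
Hypothesis xd : forall (t : R) k, 0 < t ->
  is_derive t 1 (fun s : R => x s k 0) ((G *m x t) k 0).
Local Notation mu := (@lebesgue_measure R).

Lemma bilf_sumE (M : 'M[R]_n) y z :
  bilf M y z = \sum_i \sum_j M i j * (y i 0 * z j 0).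
Proof.
rewrite /bilf -mulmxA mxE; apply: eq_bigr => i _.
by rewrite mxE mxE mulr_sumr; apply: eq_bigr => j _; ring.
Qed.

Lemma within_quadf (M : 'M[R]_n) :
  {within `[0, +oo[, continuous (fun t => quadf M (x t))}.
Proof.
apply/continuous_within_itvcyP; split=> [t t0|].
- apply: (mcvg_quadf _ (@mcvg_cst _ _ _ _ _ _ M)) => i j.
  by rewrite ord1; have /continuous_within_itvcyP[xi _] := @xc i; exact: xi.
- apply: (mcvg_quadf _ (@mcvg_cst _ _ _ _ _ _ M)) => i j.
  by rewrite ord1; have /continuous_within_itvcyP[_] := @xc i.
Qed.

Lemma is_derive_quadf (M : 'M[R]_n) (t : R) : 0 < t ->
  is_derive t 1 (fun s => quadf M (x s)) (quadf (G^T *m M + M *m G) (x t)).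
Proof.
move=> t0.
have -> : (fun s => quadf M (x s)) = \sum_(i < n) \sum_(j < n)
    (M i j \*: ((fun s => x s i 0) * (fun s => x s j 0))).
  apply/funext => s; rewrite quadfE bilf_sumE fct_sumE; apply: eq_bigr => i _.
  by rewrite fct_sumE.
have := is_derive_sum (fun i => is_derive_sum (fun j => is_deriveZ (M i j)
  (is_deriveM (xd i t0) (xd j t0)))).
move=> /is_derive_eq; apply.
rewrite quadfD.
have -> : quadf (G^T *m M) (x t) = bilf M (G *m x t) (x t).
  by rewrite /quadf /bilf trmx_mul !mulmxA.
have -> : quadf (M *m G) (x t) = bilf M (x t) (G *m x t).
  by rewrite /quadf /bilf !mulmxA.
rewrite !bilf_sumE -big_split; apply: eq_bigr => i _ /=.
rewrite -big_split; apply: eq_bigr => j _ /=.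
by rewrite /GRing.scale /=; ring.
Qed.

Lemma within_quadf_itv (M : 'M[R]_n) T :
  {within `[0, T], continuous (fun t => quadf M (x t))}.
Proof.
have sub : `[0, T] `<=` `[0, +oo[.
  by move=> t /=; rewrite !in_itv /= andbT => /andP[].
exact: (continuous_subspaceW sub (@within_quadf M)).
Qed.

Lemma measurable_quadf (M : 'M[R]_n) :
  measurable_fun (`[0, +oo[ : set R) (fun t => quadf M (x t)).
Proof.
by apply: subspace_continuous_measurable_fun => //; exact: within_quadf.
Qed.

Lemma integral_derive_quadf (M : 'M[R]_n) T : 0 < T ->
  (\int[mu]_(t in `[0%R, T]) (quadf (G^T *m M + M *m G) (x t))%:E =
   (quadf M (x T) - quadf M (x 0))%:E)%E.
Proof.
move=> T0; rewrite (@continuous_FTC2 _ _ (fun t => quadf M (x t))) //.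
- exact: within_quadf_itv.
- have [_ c0 cT] := (continuous_within_itvP _ T0).1 (@within_quadf_itv M T).
  split=> // t; rewrite in_itv /= => /andP[t0 _].
  by have [] := is_derive_quadf M t0.
- move=> t; rewrite in_itv /= => /andP[t0 _].
  by rewrite derive1E; have dVt := is_derive_quadf M t0; rewrite derive_val.
Qed.

(* (1 + d t) x^T X x is nonincreasing. *)
Lemma trajectory_cvg0 (X : 'M[R]_n) (d : R) : posdefmx X -> 0 < d ->
  (forall y, quadf (G^T *m X + X *m G) y <= - d * quadf X y) ->
  mcvg +oo%R x 0.
Proof.
move=> Xp d0 XG.
have V0 y : 0 <= quadf X y by have [_] := posdef_psd Xp.
have bound (T : R) : 0 < T -> (1 + d * T) * quadf X (x T) <= quadf X (x 0).
  move=> T0.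
  pose g (t : R) := (1 + d * t) * quadf X (x t).
  have dg (t : R) : 0 < t -> is_derive t 1 g
      ((1 + d * t) * quadf (G^T *m X + X *m G) (x t) + quadf X (x t) * d).
    move=> t0; have := is_derive_quadf X t0.
    have d1 : is_derive t 1 (fun t : R => 1 + d * t) d.
      have := is_deriveD (is_derive_cst (1 : R) t 1) (is_deriveZ d (is_derive_id t 1)).
      by move=> /is_derive_eq; apply; rewrite add0r /GRing.scale /= mulr1.
    by move=> d2; exact: is_deriveM d1 d2.
  have : g T <= g 0; last by rewrite /g mulr0 addr0 mul1r.
  apply: (@ler0_derive1_nincr R g 0 T _ _ _ 0 T) => //; last exact: ltW.
  - by move=> t; rewrite in_itv /= => /andP[t0 _]; have [] := dg _ t0.
  - move=> t; rewrite in_itv /= => /andP[t0 _].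
    rewrite derive1E; have dgt := dg _ t0; rewrite derive_val.
    have dt : 0 <= 1 + d * t by have := mulr_gt0 d0 t0; lra.
    (* By [XG] the derivative is at most [- d^2 t x^T X x]. *)
    have h1 := mulr_ge0 (mulr_ge0 (ltW (mulr_gt0 d0 t0)) (ltW d0)) (V0 (x t)).
    by have h2 := ler_wpM2l dt (XG (x t)); lra.
  - have [_ c0 cT] := (continuous_within_itvP _ T0).1 (@within_quadf_itv X T).
    have cd (t : R) : continuous_at t (fun t : R => 1 + d * t).
      by apply: cvgD; [exact: cvg_cst|apply: cvgM => //; exact: cvg_cst].
    apply/(continuous_within_itvP _ T0); split=> [t tT||].
    + have [ct _ _] := (continuous_within_itvP _ T0).1 (@within_quadf_itv X T).
      by apply: cvgM; [exact: cd|exact: ct].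
    + by apply: cvgM => //; apply: cvg_at_right_filter; exact: cd.
    + by apply: cvgM => //; apply: cvg_at_left_filter; exact: cd.
have [c c0 cX] := posdef_ge Xp.
move=> i j; rewrite ord1 mxE.
apply/cvgrPdist_lt => e e0.
near=> T.
have T0 : 0 < T by near: T; exact: nbhs_pinfty_gt.
rewrite sub0r normrN ltNge; apply/negP => exn.
have ex : e ^+ 2 <= x T i 0 ^+ 2.
  by rewrite -(real_normK (num_real (x T i 0))); have := normr_ge0 (x T i 0); nra.
have xi : c * x T i 0 ^+ 2 <= quadf X (x T).
  apply: le_trans (cX (x T)); rewrite ler_pM2l// quadf1 (bigD1 i) //= lerDl.
  by apply: sumr_ge0 => k _; exact: sqr_ge0.
have bT := bound T T0.
(* Beyond this time, an entry of size [e] would contradict [bound]. *)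
have TX : quadf X (x 0) / (d * (c * e ^+ 2)) < T by near: T; apply: nbhs_pinfty_gt; exact: num_real.
move: TX; rewrite ltr_pdivrMr; last first.
  by apply: mulr_gt0 => //; apply: mulr_gt0 => //; exact: exprn_gt0.
move=> TX.
have dT : 0 < d * T by rewrite mulr_gt0.
have h1 : c * e ^+ 2 <= quadf X (x T).
  by apply: le_trans xi; rewrite ler_pM2l.
have h2 := ler_wpM2l (ltW dT) h1.
have := V0 (x T); nra.
Unshelve. all: by end_near. Qed.

End Trajectory.

(** * The regulator problem at a single node *)

Section NodeValue.
Variables (R : realType) (n m : nat).
Variables (A : 'M[R]_n) (B : 'M[R]_(n, m)) (Q : 'M[R]_n) (Rw : 'M[R]_m).
Hypotheses (Qp : psdmx Q) (Rp : psdmx Rw).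
Variables (P : 'M[R]_n) (K : 'M[R]_(m, n)).
Hypothesis PK : ric_maximal A B Q Rw P K.
Local Notation mu := (@lebesgue_measure R).

(** The dissipation identity for [u = K' y], with the first summand shaped as the derivative of the
    form [- P] along a trajectory. *)
Lemma dissipation_feedback (K' : 'M[R]_(m, n)) y :
  quadf (Q + K'^T *m Rw *m K') y =
  quadf ((A + B *m K')^T *m - P + - P *m (A + B *m K')) y
  + quadf Rw (K' *m y - K *m y).
Proof.
have [[Ps _] _ _] := PK.
rewrite -(ric_maximal_dissipation Qp Rp y (K' *m y) PK) !quadfD quadf_congr.
rewrite mulmxN mulNmx !quadfN.
have -> : quadf ((A + B *m K')^T *m P) y = bilf P (A *m y + B *m (K' *m y)) y.
  by rewrite /quadf /bilf mulmxA -trmx_mul mulmxDl !mulmxA.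
have -> : quadf (P *m (A + B *m K')) y = bilf P y (A *m y + B *m (K' *m y)).
  by rewrite /quadf /bilf -!mulmxA mulmxDl !mulmxA.
by rewrite (bilfC _ y Ps); ring.
Qed.

(** The square vanishes for [K] itself, so the running cost is the derivative of [- x^T P x], which
    tends to 0 by stability. *)
Lemma node_optimal_cost (x : R -> 'cV[R]_n) :
  (forall k, {within `[0, +oo[, continuous (fun t : R => x t k 0)}) ->
  (forall (t : R) k, 0 < t ->
    is_derive t 1 (fun s : R => x s k 0) (((A + B *m K) *m x t) k 0)) ->
  mcvg +oo%R x 0 /\
  (\int[mu]_(t in `[0%R, +oo[) (quadf (Q + K^T *m Rw *m K) (x t))%:E =
   (quadf P (x 0))%:E)%E.
Proof.
move=> xc xd.
have [X [d [Xp d0 XG]]] := ric_maximal_stable Qp Rp PK.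
have x0 := trajectory_cvg0 xc xd Xp d0 XG; split=> //.
have dV (t : R) : 0 < t -> is_derive t 1 (fun t => quadf (- P) (x t))
    (quadf (Q + K^T *m Rw *m K) (x t)).
  move=> t0; have := is_derive_quadf xd (- P) t0 => /is_derive_eq; apply.
  by rewrite dissipation_feedback subrr quadf_0r addr0.
rewrite (@ge0_continuous_FTC2y _ _ (fun t => quadf (- P) (x t)) _ 0) //.
- by rewrite sub0e -EFinN quadfN opprK.
- move=> t _; have [_] : psdmx (Q + K^T *m Rw *m K); last by [].
  by apply: psdmxD => //; exact: psdmx_congr.
- exact: within_quadf.
- by rewrite -(quadf_0r (- P)); exact: (mcvg_quadf _ (@mcvg_cst _ _ _ _ _ _ (- P)) x0).
- by move=> t t0; have [] := dV _ t0.
- by have /continuous_within_itvcyP[_] := within_quadf xc (M := - P).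
- move=> t; rewrite in_itv /= andbT => t0.
  by rewrite derive1E; have dVt := dV _ t0; rewrite derive_val.
Qed.

(** Integration up to [T] gives [V(0) - V(T) <= J] for [V = x^T P x]. If [J < V(0)], then [V] never
    drops below the gap [e]: impossible when [x] tends to 0, and for positive definite [Q] the
    running cost stays above some [r > 0], so that [J] would be infinite. *)
Lemma node_cost_ge (K' : 'M[R]_(m, n)) (x : R -> 'cV[R]_n) :
  (forall k, {within `[0, +oo[, continuous (fun t : R => x t k 0)}) ->
  (forall (t : R) k, 0 < t ->
    is_derive t 1 (fun s : R => x s k 0) (((A + B *m K') *m x t) k 0)) ->
  posdefmx Q \/ mcvg +oo%R x 0 ->
  ((quadf P (x 0))%:E <=
   \int[mu]_(t in `[0%R, +oo[) (quadf (Q + K'^T *m Rw *m K') (x t))%:E)%E.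
Proof.
move=> xc xd xQ; set M := Q + K'^T *m Rw *m K'.
have [Pp _ _] := PK.
have Mp : psdmx M by apply: psdmxD => //; exact: psdmx_congr.
have M0 t : 0 <= quadf M (x t) by have [_] := Mp.
have V0 t : 0 <= quadf P (x t) by have [_] := posdef_psd Pp.
set J := (\int[mu]_(t in _) _)%E.
have J0 : (0 <= J)%E by apply: integral_ge0 => t _; rewrite lee_fin.
have JT T : (\int[mu]_(t in `[0%R, T]) (quadf M (x t))%:E <= J)%E.
  apply: ge0_subset_integral => //.
  - by apply/measurable_EFinP; exact: measurable_quadf.
  - by move=> t _; rewrite lee_fin.
  - by move=> t /=; rewrite !in_itv /= andbT => /andP[].
have intgb (N : 'M[R]_n) T :
    mu.-integrable `[0, T] (EFin \o (fun t => quadf N (x t))).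
  apply: continuous_compact_integrable; first exact: segment_compact.
  exact: within_quadf_itv.
have lowT (T : R) : 0 < T -> ((quadf P (x 0) - quadf P (x T))%:E <= J)%E.
  move=> T0; apply: le_trans (JT T).
  have := integral_derive_quadf xc xd (- P) T0.
  rewrite !quadfN opprK (addrC (- quadf P (x T))) => <-.
  apply: le_integral => //; [exact: intgb..|].
  move=> t _; rewrite lee_fin /M dissipation_feedback lerDl.
  by have [_] := Rp.
have [->|Jfin] := eqVneq J +oo%E; first by rewrite leey.
have Jr : J = (fine J)%:E.
  by rewrite fineK// ge0_fin_numE// lt_neqAle Jfin leey.
rewrite Jr lee_fin leNgt; apply/negP => JV.
set e := quadf P (x 0) - fine J.
have e0 : 0 < e by rewrite subr_gt0.
have fJ0 : 0 <= fine J by rewrite -lee_fin -Jr.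
have VT (T : R) : 0 <= T -> e <= quadf P (x T).
  rewrite le_eqVlt => /predU1P[<-|T0]; first by rewrite /e gerBl.
  by have := lowT _ T0; rewrite Jr lee_fin /e; lra.
case: xQ => [Qpd|x0].
- have [c c0 cQ] := posdef_ge Qpd.
  have tP := psd_tr_ge0 (posdef_psd Pp).
  (* [V >= e] gives [|x|^2 >= e / (1 + tr P)], and [c] bounds [Q] below. *)
  set r := c * (e / (1 + \tr P)).
  have r0 : 0 < r by rewrite mulr_gt0// divr_gt0//; lra.
  have rM (t : R) : 0 <= t -> r <= quadf M (x t).
    move=> t0; rewrite /M quadfD quadf_congr.
    have h1 := cQ (x t); have [_ /(_ (K' *m x t)) h2] := Rp.
    suff h3 : e / (1 + \tr P) <= quadf 1%:M (x t).
      have := ler_wpM2l (ltW c0) h3; rewrite -/r; lra.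
    rewrite ler_pdivrMr; last by lra.
    apply: le_trans (VT t t0) _; apply: le_trans (psd_le_tr _ (posdef_psd Pp)) _.
    by have := quadf1_ge0 (x t); nra.
  (* Long enough for the rate [r] to accumulate [J + 1]. *)
  set T := (fine J + 1) / r.
  have T0 : 0 < T by rewrite divr_gt0//; lra.
  have : ((fine J + 1)%:E <= J)%E.
    apply: le_trans (JT T).
    have -> : ((fine J + 1)%:E = \int[mu]_(t in `[0%R, T]) (cst r%:E) t)%E.
      rewrite integral_cst//= lebesgue_measure_itv/= lte_fin T0 sube0 -EFinM.
      by rewrite /T mulrC divfK// gt_eqF.
    apply: ge0_le_integral => //.
    + by move=> t _; rewrite lee_fin ltW.
    + by apply/measurable_EFinP; apply: subspace_continuous_measurable_fun => //;
        exact: within_quadf_itv.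
    + by move=> t /=; rewrite in_itv /= lee_fin => /andP[/rM].
  by rewrite Jr lee_fin; lra.
- have Px : quadf P (x T) @[T --> +oo] --> (0 : R).
    rewrite -(quadf_0r P).
    exact: (mcvg_quadf _ (@mcvg_cst _ _ _ _ _ _ P) x0).
  have [T [T0 PT]] : exists T, 0 <= T /\ quadf P (x T) < e.
    have near_e : \forall T \near +oo, quadf P (x T) < e.
      by apply: cvgr_lt Px _ _.
    have near_0 : \forall T \near +oo, 0 <= T :> R by exact: nbhs_pinfty_ge.
    near (pinfty_nbhs R) => T; exists T; split; near: T => //.
  by have := VT _ T0; rewrite leNgt PT.
Unshelve. all: by end_near. Qed.

End NodeValue.

(** * Gauss quadrature at the roots of [phi N.+1] *)

Section Quadrature.
Variables (R : realType) (N : nat) (D : set R) (f : R -> R).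
Hypothesis hf : is_density D f.
Variable phi : nat -> {poly R}.
Hypothesis hphi : is_pc_basis D f phi.
Variable node : 'I_N.+1 -> R.
Hypothesis hnode : are_roots (phi N.+1) node.
Local Notation mu := (@lebesgue_measure R).

Let mD : measurable (D : set (measurableTypeR R)).
Proof. by have [] := hf. Qed.

Let mf : measurable_fun (D : set (measurableTypeR R)) f.
Proof. by have [] := hf. Qed.

Let f0 d : D d -> 0 <= f d.
Proof. by have [_ _ + _] := hf; apply. Qed.

(** A multiple of [phi j], of degree exactly [j], cancels a leading term, so the first [k] basis
    polynomials span all degrees below [k]. As an induction principle this yields both integrability
    and orthogonality. *)
Lemma pc_basis_ind (S : {poly R} -> Prop) k :
  S 0 -> (forall a p j, (j < k)%N -> S p -> S (p + a *: phi j)) ->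
  forall p : {poly R}, (size p <= k)%N -> S p.
Proof.
have [szphi _ _] := hphi.
move=> S0 Sadd; suff IH j (p : {poly R}) : (j <= k)%N -> (size p <= j)%N -> S p.
  by move=> p; exact: IH.
elim: j p => [|j IH] p jk szp.
  by have /eqP -> : p == 0 by rewrite -size_poly_eq0 -leqn0.
pose a := p`_j / (phi j)`_j.
rewrite -(subrK (a *: phi j) p); apply: Sadd => //; apply: IH; first exact: ltnW.
apply/leq_sizeP => i; rewrite leq_eqVlt coefB coefZ => /predU1P[<-|ji].
  rewrite /a divfK ?subrr//.
  have : lead_coef (phi j) != 0 by rewrite lead_coef_eq0 -size_poly_eq0 szphi.
  by rewrite lead_coefE szphi.
rewrite [p`_i]nth_default ?(leq_trans szp)//.
by rewrite [X in a * X]nth_default ?mulr0 ?subr0// szphi.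
Qed.

(** Integrability is given for products [phi i * phi j] only; [phi 0] is a nonzero constant, so each
    [phi j] is a multiple of such a product. *)
Lemma integrable_poly (p : {poly R}) :
  mu.-integrable D (fun d => (p.[d] * f d)%:E).
Proof.
have [szphi iphi _] := hphi.
apply: (pc_basis_ind (S := fun p => mu.-integrable D (fun d => (p.[d] * f d)%:E)))
  (leqnn (size p)) => [|a q j _ iq].
  apply: eq_integrable (integrable0 _ _) => // d _ /=.
  by rewrite horner0 mul0r.
have [c phi0] : exists c, phi 0%N = c%:P.
  by exists (phi 0%N)`_0; apply: size1_polyC; rewrite szphi.
have c0 : c != 0 by rewrite -polyC_eq0 -phi0 -size_poly_eq0 szphi.
have := integrableZl mD (a / c) (iphi j 0%N).
move=> /(integrableD mD iq); apply: eq_integrable => // d _ /=.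
rewrite -EFinM -EFinD hornerD hornerZ phi0 hornerC; congr EFin.
by field.
Qed.

Definition Ep (p : {poly R}) : R := Ex D f (horner p).

Lemma EpE p : (\int[mu]_(d in D) (p.[d] * f d)%:E)%E = (Ep p)%:E.
Proof.
rewrite /Ep /Ex /Rintegral fineK//.
exact: integrable_fin_num (integrable_poly p).
Qed.

Lemma EpD p q : Ep (p + q) = Ep p + Ep q.
Proof.
rewrite /Ep /Ex -RintegralD//; try exact: integrable_poly.
by apply: eq_Rintegral => d _; rewrite hornerD mulrDl.
Qed.

Lemma EpZ a p : Ep (a *: p) = a * Ep p.
Proof.
rewrite /Ep /Ex -RintegralZl//; last exact: integrable_poly.
by apply: eq_Rintegral => d _; rewrite hornerZ mulrA.
Qed.

Lemma Ep0 : Ep 0 = 0.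
Proof. by rewrite -(scale0r 0) EpZ mul0r. Qed.

Lemma Ep_sum I (r : seq I) (F : I -> {poly R}) :
  Ep (\sum_(i <- r) F i) = \sum_(i <- r) Ep (F i).
Proof.
elim: r => [|i r IH]; first by rewrite !big_nil Ep0.
by rewrite !big_cons EpD IH.
Qed.

Lemma pc_orthogonal (p : {poly R}) : (size p <= N.+1)%N -> Ep (phi N.+1 * p) = 0.
Proof.
have [_ _ ophi] := hphi.
apply: (pc_basis_ind (S := fun p => Ep (phi N.+1 * p) = 0)) => [|a q j jN q0].
  by rewrite mulr0 Ep0.
rewrite mulrDr EpD q0 add0r -scalerAr EpZ.
rewrite (_ : Ep _ = 0) ?mulr0// -(ophi N.+1 j); last by rewrite gt_eqF.
by apply: eq_Rintegral => d _; rewrite hornerM.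
Qed.

Definition lagrp (i : 'I_N.+1) : {poly R} :=
  \prod_(j < N.+1 | j != i) ((node i - node j)^-1 *: ('X - (node j)%:P)).

Lemma lagrpE i d : lagr node i d = (lagrp i).[d].
Proof.
rewrite /lagr /lagrp horner_prod; apply: eq_bigr => j _.
by rewrite hornerZ hornerXsubC mulrC.
Qed.

Lemma node_neq i j : j != i -> node i - node j != 0.
Proof.
have [ninj _] := hnode; move=> ji; rewrite subr_eq0.
by apply: contraNneq ji => /ninj ->.
Qed.

Lemma lagr_node i j : lagr node i (node j) = (i == j)%:R.
Proof.
have [->|ij] := eqVneq i j.
  by rewrite /lagr big1// => k kj; rewrite divff// node_neq.
by rewrite /lagr (bigD1 j) 1?eq_sym//= subrr !mul0r.
Qed.

Lemma lagrp_scale i : exists2 c, c != 0 &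
  lagrp i = c *: \prod_(j < N.+1 | j != i) ('X - (node j)%:P).
Proof.
exists (\prod_(j < N.+1 | j != i) (node i - node j)^-1).
  by apply/prodf_neq0 => j ji; rewrite invr_eq0 node_neq.
by rewrite /lagrp scaler_prod.
Qed.

Lemma size_prod_nodes (P : pred 'I_N.+1) :
  size (\prod_(j < N.+1 | P j) ('X - (node j)%:P)) = #|P|.+1.
Proof. by rewrite -big_filter size_prod_XsubC cardE /enum_mem. Qed.

Lemma size_lagrp i : (size (lagrp i) <= N.+1)%N.
Proof.
have [c _ ->] := lagrp_scale i.
apply: leq_trans (size_scale_leq _ _) _.
by rewrite (size_prod_nodes (fun j => j != i)) (cardC1 i) card_ord.
Qed.

Lemma phi_factor : exists2 c, c != 0 &
  phi N.+1 = c *: \prod_(j < N.+1) ('X - (node j)%:P).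
Proof.
have [szphi _ _] := hphi; have [ninj nroot] := hnode.
exists (lead_coef (phi N.+1)); first by rewrite lead_coef_eq0 -size_poly_eq0 szphi.
rewrite {1}(@all_roots_prod_XsubC _ (phi N.+1) (map node (enum 'I_N.+1))).
- by rewrite big_map big_enum.
- by rewrite size_map szphi size_enum_ord.
- by apply/allP => _ /mapP[j _ ->]; exact: nroot.
- by rewrite uniq_rootsE map_inj_uniq// enum_uniq.
Qed.

(** For distinct indices the product vanishes at every node, hence is [phi N.+1] times a cofactor of
    lower degree, to which [phi N.+1] is orthogonal. *)
Lemma Ep_lagrp_neq i j : i != j -> Ep (lagrp i * lagrp j) = 0.
Proof.
move=> ij; have [c c0 phiE] := phi_factor.
have [ci _ ->] := lagrp_scale i; have [cj _ ->] := lagrp_scale j.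
rewrite [X in _ * (cj *: X)](bigD1 i)//=.
set r := \prod_(k < N.+1 | _ && _) _.
have -> : (ci *: \prod_(k < N.+1 | k != i) ('X - (node k)%:P)) *
    (cj *: (('X - (node i)%:P) * r)) = (ci * cj / c) *: (phi N.+1 * r).
  rewrite phiE [in RHS](bigD1 i)//= -!scalerAl -!scalerAr !scalerA.
  rewrite divfK//; congr (_ *: _); ring.
rewrite EpZ pc_orthogonal ?mulr0//.
rewrite /r (size_prod_nodes (fun k => (k != j) && (k != i))) ltnS.
have eN := cardD1 i (predC1 j); rewrite cardC1 card_ord inE ij /= in eN.
apply: (@leq_trans #|[predD1 (predC1 j) & i]|).
  by apply: eq_leq; apply: eq_card => k; rewrite !inE andbC.
by apply: ltnW; exact: eq_leq (esym eN).
Qed.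

(** The difference from 1 has degree at most [N] and [N+1] distinct roots. *)
Lemma sum_lagrp : \sum_(i < N.+1) lagrp i = 1.
Proof.
have [ninj _] := hnode.
apply/eqP; rewrite -subr_eq0; apply/eqP.
apply: (@roots_geq_poly_eq0 _ _ (map node (enum 'I_N.+1))).
- apply/allP => _ /mapP[j _ ->]; rewrite /root hornerD hornerN hornerC horner_sum.
  rewrite (bigD1 j)//= -lagrpE lagr_node eqxx big1 ?addr0 ?subrr// => k kj.
  by rewrite -lagrpE lagr_node (negPf kj).
- by rewrite map_inj_uniq// enum_uniq.
- rewrite size_map size_enum_ord.
  apply: leq_trans (size_polyD _ _) _; rewrite geq_max size_polyN size_poly1 andbT.
  by apply: leq_trans (size_sum _ _ _) _; apply/bigmax_leqP => i _; exact: size_lagrp.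
Qed.

(** On the diagonal, inserting [1 = \sum_k l_k] gives [E[l_i] = \sum_k E[l_i l_k] = E[l_i^2]]. *)
Lemma Ep_lagrp i j : Ep (lagrp i * lagrp j) = (i == j)%:R * Ep (lagrp i).
Proof.
have [<-|ij] := eqVneq i j; last by rewrite mul0r Ep_lagrp_neq.
rewrite mul1r -[in RHS](mulr1 (lagrp i)) -sum_lagrp mulr_sumr Ep_sum.
rewrite (bigD1 i)//= [X in _ + X]big1 ?addr0// => k ki.
by rewrite Ep_lagrp_neq// eq_sym.
Qed.

(** If [E[l_i] = E[l_i^2]] were 0, then [l_i^2 f] would vanish almost everywhere on [D]; [l_i] has
    finitely many zeros, so [f] would too, against its integral 1. *)
Lemma Ep_lagrp_gt0 i : 0 < Ep (lagrp i).
Proof.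
have [_ _ _ f1] := hf.
have <- : Ep (lagrp i * lagrp i) = Ep (lagrp i) by rewrite Ep_lagrp eqxx mul1r.
set p := lagrp i * lagrp i.
have p0 d : 0 <= p.[d] by rewrite /p hornerM -expr2 sqr_ge0.
rewrite lt_def Rintegral_ge0 ?andbT; last first.
  by move=> d Dd; rewrite mulr_ge0// f0.
apply/eqP => Ep_eq0.
have mpf : measurable_fun D (fun d => (p.[d] * f d)%:E).
  by case/integrableP : (integrable_poly p).
have : (\int[mu]_(d in D) `|(p.[d] * f d)%:E|)%E = 0.
  rewrite -[RHS]/(0%:E) -Ep_eq0 -EpE; apply: eq_integral => d /[!inE] Dd.
  by rewrite gee0_abs// lee_fin mulr_ge0// f0.
move=> /(ae_eq_integral_abs mu mD mpf) pf0.
suff ff0 : ae_eq mu D (EFin \o f) (cst 0%E).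
  move: f1; rewrite (ae_eq_integral (cst 0%E)) ?integral0//; last first.
    exact/measurable_EFinP.
  by move=> /eqP; rewrite eq_sym onee_eq0.
have nodes0 : {ae mu, forall d, p.[d] != 0}.
  have fin : finite_set (range node) by exact: finite_image.
  exists (range node); split.
  - exact: countable_measurable (finite_set_countable fin).
  - exact: countable_lebesgue_measure0 (finite_set_countable fin).
  - move=> d /= /negP; rewrite negbK /p hornerM -expr2 sqrf_eq0.
    have [c c0 ->] := lagrp_scale i.
    rewrite hornerZ mulf_eq0 (negPf c0) /= horner_prod => /prodf_eq0[j _].
    by rewrite hornerXsubC subr_eq0 => /eqP ->; exists j.
apply: filterS2 pf0 nodes0 => d pf0 pn0 Dd /=.
have := pf0 Dd => /= -[] /eqP; rewrite mulf_eq0 (negPf pn0) /= => /eqP ->.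
by [].
Qed.

End Quadrature.

(** * Exact quadrature of the expected cost *)

Section CollocationCost.
Variables (R : realType) (N : nat) (D : set R) (f : R -> R).
Hypothesis hf : is_density D f.
Variable phi : nat -> {poly R}.
Hypothesis hphi : is_pc_basis D f phi.
Variable node : 'I_N.+1 -> R.
Hypothesis hnode : are_roots (phi N.+1) node.
Local Notation mu := (@lebesgue_measure R).
Local Notation lagrp := (lagrp node).
Local Notation Ep := (Ep D f).

Let mD : measurable (D : set (measurableTypeR R)).
Proof. by have [] := hf. Qed.

Let mf : measurable_fun (D : set (measurableTypeR R)) f.
Proof. by have [] := hf. Qed.

Let f0 d : D d -> 0 <= f d.
Proof. by have [_ _ + _] := hf; apply. Qed.

(** The shape in [d] of any quadratic form of a collocation expansion; its expectation keeps only
    the diagonal coefficients. *)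
Definition colloc_poly (c : 'I_N.+1 -> 'I_N.+1 -> R) : {poly R} :=
  \sum_(i < N.+1) \sum_(j < N.+1) c i j *: (lagrp i * lagrp j).

Lemma Ep_colloc c : Ep (colloc_poly c) = \sum_(i < N.+1) Ep (lagrp i) * c i i.
Proof.
rewrite (Ep_sum hf hphi); apply: eq_bigr => i _.
rewrite (Ep_sum hf hphi) (bigD1 i)//= [X in _ + X]big1 => [|j ji].
  by rewrite addr0 (EpZ hf hphi) (Ep_lagrp hf hphi hnode) eqxx mul1r mulrC.
by rewrite (EpZ hf hphi) (Ep_lagrp hf hphi hnode) eq_sym (negPf ji) mul0r mulr0.
Qed.

Lemma colloc_polyE c d : (colloc_poly c).[d] =
  \sum_(i < N.+1) \sum_(j < N.+1) c i j * ((lagrp i).[d] * (lagrp j).[d]).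
Proof.
rewrite horner_sum; apply: eq_bigr => i _; rewrite horner_sum.
by apply: eq_bigr => j _; rewrite hornerZ hornerM.
Qed.

Lemma quadf_expansion p (M : 'M[R]_p) (g : R -> 'cV[R]_p) d :
  quadf M (expansion node g d) =
  (colloc_poly (fun i j => bilf M (g (node i)) (g (node j)))).[d].
Proof.
rewrite quadfE colloc_polyE /expansion.
have bilf0l z : bilf M 0 z = 0 by rewrite -(scale0r 0) bilfZl mul0r.
have bilf0r z : bilf M z 0 = 0 by rewrite -(scale0r 0) bilfZr mul0r.
rewrite (big_morph (fun y => bilf M y _) (fun y z => bilfDl M y z _) (bilf0l _)).
apply: eq_bigr => i _.
rewrite (big_morph (bilf M _) (fun y z => bilfDr M y z _) (bilf0r _)).
by apply: eq_bigr => j _; rewrite bilfZl bilfZr !lagrpE; ring.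
Qed.

Section Tonelli.
Variable c : 'I_N.+1 -> 'I_N.+1 -> R -> R.
Local Notation I := (`[0%R, +oo[%classic : set R).
Hypothesis mc : forall i j, measurable_fun (I : set (measurableTypeR R)) (c i j).
Hypothesis cii : forall i t, I t -> 0 <= c i i t.
Hypothesis c0 : forall t d, I t -> 0 <= (colloc_poly (fun i j => c i j t)).[d].

(** The off-diagonal coefficients have no sign, so Tonelli is applied to the whole nonnegative
    polynomial; only after quadrature at fixed [t] is the sum split. *)
Lemma expected_cost :
  Exe D f (fun d => (\int[mu]_(t in I) ((colloc_poly (fun i j => c i j t)).[d])%:E)%E) =
  (\sum_(i < N.+1) (Ep (lagrp i))%:E * \int[mu]_(t in I) (c i i t)%:E)%E.
Proof.
have mI : measurable (I : set (measurableTypeR R)) by [].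
(* Extension by zero, so that Tonelli applies on the full plane. *)
pose fD := f \_ D.
have mfD : measurable_fun (setT : set (measurableTypeR R)) fD.
  exact: (measurable_restrictT f mD).1 mf.
pose cI i j := c i j \_ I.
have mcI i j : measurable_fun (setT : set (measurableTypeR R)) (cI i j).
  exact: (measurable_restrictT (c i j) mI).1 (mc i j).
pose h (z : measurableTypeR R * measurableTypeR R) : R :=
  (\sum_(i < N.+1) \sum_(j < N.+1)
    cI i j z.2 * ((lagrp i).[z.1] * (lagrp j).[z.1])) * fD z.1.
have hE d t : I t -> D d ->
    h (d, t) = (colloc_poly (fun i j => c i j t)).[d] * f d.
  move=> It Dd; rewrite colloc_polyE /h /fD patchE mem_set//=; congr (_ * _).
  apply: eq_bigr => i _; apply: eq_bigr => j _.
  by rewrite /cI patchE mem_set.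
have hD d t : ~ D d -> h (d, t) = 0.
  by move=> Dd; rewrite /h /fD patchE memNset// mulr0.
have hI d t : ~ I t -> h (d, t) = 0.
  move=> It; rewrite /h big1 ?mul0r// => i _; rewrite big1// => j _.
  by rewrite /cI patchE memNset// mul0r.
have h0 z : 0 <= h z.
  case: z => d t.
  have [Dd|/hD->//] := pselect (D d); have [It|/(hI d)->//] := pselect (I t).
  by rewrite hE// mulr_ge0 ?c0 ?f0.
have mp i : measurable_fun (setT : set (measurableTypeR R)) (horner (lagrp i)).
  exact: measurable_poly.
have mh : measurable_fun setT (EFin \o h).
  apply/measurable_EFinP; apply: measurable_funM; last first.
    by apply: measurableT_comp => //; exact: measurable_fst.
  apply: measurable_sum => i; apply: measurable_sum => j.
  apply: measurable_funM.
    by apply: measurableT_comp => //; exact: measurable_snd.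
  apply: measurable_funM; [have := mp i|have := mp j] => mpk;
    exact: (measurableT_comp mpk measurable_fst).
transitivity (\int[mu]_d \int[mu]_t (h (d, t))%:E)%E.
  rewrite /Exe integral_mkcond; apply: eq_integral => d _; rewrite patchE.
  case: ifPn => [/set_mem Dd|/negP Dd]; last first.
    rewrite integral0_eq// => t _; rewrite hD//.
    by move=> Dd'; apply: Dd; rewrite inE.
  rewrite -ge0_integralZr//.
  - rewrite integral_mkcond; apply: eq_integral => t _; rewrite patchE.
    case: ifPn => [/set_mem It|/negP It]; first by rewrite hE.
    by rewrite hI// => It'; apply: It; rewrite inE.
  - apply/measurable_EFinP.
    rewrite (_ : (fun t => _) = (fun t => \sum_(i < N.+1) \sum_(j < N.+1)
        c i j t * ((lagrp i).[d] * (lagrp j).[d]))); last first.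
      by apply/funext => t; rewrite colloc_polyE.
    apply: measurable_sum => i; apply: measurable_sum => j.
    by apply: measurable_funM => //; exact: mc.
  - by move=> t It; rewrite lee_fin c0.
  - by rewrite lee_fin f0.
rewrite (@fubini_tonelli _ _ _ _ _ mu mu (EFin \o h))//.
transitivity (\int[mu]_(t in I) (\sum_(i < N.+1) (Ep (lagrp i))%:E * (c i i t)%:E))%E.
  rewrite [RHS]integral_mkcond; apply: eq_integral => t _; rewrite patchE.
  case: ifPn => [/set_mem It|/negP It]; last first.
    rewrite integral0_eq// => d _ /=; rewrite hI//.
    by move=> It'; apply: It; rewrite inE.
  transitivity (\int[mu]_(d in D) ((colloc_poly (fun i j => c i j t)).[d] * f d)%:E)%E.
    rewrite [RHS]integral_mkcond; apply: eq_integral => d _ /=; rewrite patchE.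
    case: ifPn => [/set_mem Dd|/negP Dd]; first by rewrite hE.
    by rewrite hD// => Dd'; apply: Dd; rewrite inE.
  rewrite (EpE hf hphi) Ep_colloc -sumEFin.
  by apply: eq_bigr => i _; rewrite EFinM.
rewrite ge0_integral_sum//.
- apply: eq_bigr => i _; rewrite ge0_integralZl_EFin//.
  + by move=> t It; rewrite lee_fin cii.
  + by apply/measurable_EFinP; exact: mc.
  + by apply: ltW; exact: (Ep_lagrp_gt0 hf hphi hnode i).
- move=> i; apply/measurable_EFinP.
  by apply: measurable_funM => //; exact: mc.
- move=> i t It; rewrite -EFinM lee_fin mulr_ge0 ?cii//.
  by apply: ltW; exact: (Ep_lagrp_gt0 hf hphi hnode i).
Qed.

End Tonelli.

End CollocationCost.

(** * Block columns and diagonal blocks *)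

Section BlockMatrices.
Variables (R : realType) (N : nat).

(** [a] stands for the values of the interpolants at node [i], where [Lmx] is the [i]-th block unit
    column. *)
Lemma mul_tr_mxcol_scalar p q (a : 'I_N.+1 -> R) (i : 'I_N.+1)
    (C : 'I_N.+1 -> 'M[R]_(p, q)) :
  (forall j, a j = (i == j)%:R) ->
  (\mxcol_(j < N.+1) ((a j)%:M : 'M[R]_p))^T *m \mxcol_(j < N.+1) C j = C i.
Proof.
move=> ai; rewrite tr_mxcol mul_mxrow_mxcol (bigD1 i)//= big1 => [|j ji].
  by rewrite addr0 ai eqxx tr_scalar_mx mul1mx.
by rewrite ai eq_sym (negPf ji) tr_scalar_mx mul_scalar_mx scale0r.
Qed.

Lemma submxblock_scalar p (a : 'I_N.+1 -> R) (i : 'I_N.+1)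
    (Y : 'M[R]_(\sum_(j < N.+1) p)) :
  (forall j, a j = (i == j)%:R) ->
  (\mxcol_(j < N.+1) ((a j)%:M : 'M[R]_p))^T *m Y
    *m \mxcol_(j < N.+1) ((a j)%:M : 'M[R]_p) = Yblk Y i.
Proof.
move=> ai; rewrite -mulmxA -{1}(submxblockK Y) mul_mxblock_mxrow.
rewrite (mul_tr_mxcol_scalar _ ai) (bigD1 i)//= big1 => [|j ji].
  by rewrite addr0 ai eqxx mulmx1.
by rewrite ai eq_sym (negPf ji) -scalemx1 -scalemxAr scale0r.
Qed.

Lemma posdef_Yblk p (Y : 'M[R]_(\sum_(j < N.+1) p)) (i : 'I_N.+1) :
  posdefmx Y -> posdefmx (Yblk Y i).
Proof.
move=> [Ys Y0]; split=> [|v v0].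
  by rewrite /Yblk tr_submxblock Ys.
rewrite -(@submxblock_scalar _ (fun j => (i == j)%:R))// quadf_congr.
apply: Y0; apply: contraNneq v0 => Ev.
have := @mul_tr_mxcol_scalar _ _ (fun j => (i == j)%:R) i
  (fun j => ((i == j)%:R)%:M : 'M[R]_p) (fun=> erefl).
rewrite eqxx => /(congr1 (mulmx^~ v)); rewrite mul1mx => <-.
by rewrite -mulmxA Ev mulmx0.
Qed.

Lemma posdef_mxdiag p (V : 'I_N.+1 -> 'M[R]_p) :
  (forall i, posdefmx (V i)) -> posdefmx (\mxdiag_(i < N.+1) V i).
Proof.
move=> Vp; split=> [|x x0].
  by rewrite tr_mxdiag; apply: eq_mxdiag => i; exact: (proj1 (Vp i)).
have -> : quadf (\mxdiag_(i < N.+1) V i) x =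
    \sum_(i < N.+1) quadf (V i) (submxcol x i : 'cV_p).
  rewrite /quadf -{1 2}(submxcolK x) -mulmxA mul_mxdiag_mxcol tr_mxcol.
  rewrite mul_mxrow_mxcol summxE; apply: eq_bigr => i _.
  by rewrite mulmxA.
have V0 i : 0 <= quadf (V i) (submxcol x i : 'cV_p).
  by have [_] := posdef_psd (Vp i).
rewrite lt_def (sumr_ge0 _ (fun i _ => V0 i)) andbT.
apply: contraNneq x0 => /eqP; rewrite psumr_eq0 => [/allP sx|i _]; last exact: V0.
apply/eqP/mxcolP => i; rewrite submxcol0.
apply/eqP; apply: contraT => xi.
have := proj2 (Vp i) _ xi.
by have /eqP -> := sx i (mem_index_enum _); rewrite ltxx.
Qed.

End BlockMatrices.

(** * Decoupling of the program and of the cost *)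

Section Assembly.
Variables (R : realType) (n m N : nat) (D : set R) (f : R -> R).
Hypothesis hf : is_density D f.
Variable phi : nat -> {poly R}.
Hypothesis hphi : is_pc_basis D f phi.
Variable node : 'I_N.+1 -> R.
Hypothesis hnode : are_roots (phi N.+1) node.
Variables (A : R -> 'M[R]_n) (B : R -> 'M[R]_(n, m)).
Variables (Q : 'M[R]_n) (Rw : 'M[R]_m).
Hypotheses (hQ : psdmx Q) (hR : psdmx Rw).
Local Notation mu := (@lebesgue_measure R).
Local Notation w i := (Ep D f (lagrp node i)).

Lemma ELE k i : EL D f node k i = (w i)%:M.
Proof.
apply/matrixP => a b; rewrite /EL /Emx !mxE.
transitivity (Ep D f ((a == b)%:R *: lagrp node i)); last first.
  by rewrite (EpZ hf hphi) mulr_natl.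
apply: eq_Rintegral => d _.
by rewrite mxE hornerZ lagrpE mulr_natl.
Qed.

(** The weight enters [M11] linearly and the other blocks through square roots, so the Schur
    complement is [w_i U^T X U] with [U = Y_ii] and [X] the Riccati residual; [w_i > 0] and [U] is
    invertible. *)
Lemma lmi_ric (Y : 'M[R]_(\sum_(i < N.+1) n)) (W : 'I_N.+1 -> 'M[R]_(m, n)) i :
  posdefmx (Yblk Y i) ->
  nsdmx (LMI D f node A B Q Rw Y W i) <->
  nsdmx (ric (A (node i)) (B (node i)) Q Rw (invmx (Yblk Y i))
           (W i *m invmx (Yblk Y i))).
Proof.
move=> Up; set U := Yblk Y i in Up *; have Uu := posdef_unit Up.
have [Us _] := Up; have w0 := Ep_lagrp_gt0 hf hphi hnode i.
set X := ric _ _ _ _ _ _.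
have sqrtE k (S : 'M[R]_k) : psdmx S ->
    sqrtmx ((w i)%:M *m S) *m (sqrtmx ((w i)%:M *m S))^T = w i *: S.
  move=> Sp; have [|[-> _] ->] := @sqrtmxP R k ((w i)%:M *m S).
    by rewrite mul_scalar_mx; apply: psdmxZ => //; exact: ltW.
  by rewrite mul_scalar_mx.
have congrE k (C : 'M[R]_(k, n)) (S : 'M[R]_k) : psdmx S ->
    let T := sqrtmx ((w i)%:M *m S) in
    (C^T *m T) *m (C^T *m T)^T = w i *: (C^T *m S *m C).
  move=> Sp /=; rewrite trmx_mul trmxK -mulmxA (mulmxA (sqrtmx _)) sqrtE//.
  by rewrite -scalemxAl -scalemxAr mulmxA.
have E : M11 D f node A B Y W i + M12 D f node Q Y i *m (M12 D f node Q Y i)^T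
    + M13 D f node Rw W i *m (M13 D f node Rw W i)^T = w i *: (U^T *m X *m U).
  rewrite /M11 /M12 /M13 !ELE -/U !congrE//.
  rewrite !mul_mx_scalar Us /sym /X /ric.
  have -> : U *m ((A (node i) + B (node i) *m (W i *m invmx U))^T *m invmx U
      + invmx U *m (A (node i) + B (node i) *m (W i *m invmx U))
      + Q + (W i *m invmx U)^T *m Rw *m (W i *m invmx U)) *m U =
      U *m (A (node i))^T + (W i)^T *m (B (node i))^T
      + A (node i) *m U + B (node i) *m W i + U *m Q *m U
      + (W i)^T *m Rw *m W i.
    have iUs : (invmx U)^T = invmx U by rewrite trmx_inv Us.
    mxexpand; rewrite ?iUs !(mulmxKV Uu) (mulmxV Uu) !mul1mx; mxabel.
  by mxexpand; rewrite ?Us; mxabel.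
rewrite /LMI nsd_schur E; split=> [|Xn].
- rewrite /nsdmx => h.
  have -> : - X = (w i)^-1 *: ((invmx U)^T *m (- (w i *: (U^T *m X *m U))) *m invmx U).
    rewrite mulmxN mulNmx -scalemxAr -scalemxAl scalerN scalerA mulVf ?gt_eqF//.
    rewrite scale1r !mulmxA -trmx_mul mulmxV// trmx1 mul1mx.
    by rewrite -mulmxA mulmxV// mulmx1.
  by apply: psdmxZ; [rewrite invr_ge0 ltW|exact: psdmx_congr].
- rewrite /nsdmx -scalerN -mulNmx -mulmxN.
  by apply: psdmxZ; [exact: ltW|exact: psdmx_congr].
Qed.

Lemma objectiveE (Y : 'M[R]_(\sum_(i < N.+1) n)) :
  objective D f node Y = \sum_(i < N.+1) w i * \tr (Yblk Y i).
Proof.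
rewrite /objective raddf_sum; apply: eq_bigr => i _.
by rewrite /= ELE mul_scalar_mx mxtraceZ.
Qed.

Section Optimum.
Variables (Y : 'M[R]_(\sum_(i < N.+1) n)) (W : 'I_N.+1 -> 'M[R]_(m, n)).
Hypothesis hYW : solves_program D f node A B Q Rw Y W.

Let P i := invmx (Yblk Y i).
Let K i := W i *m invmx (Yblk Y i).

(** A competitor at node [i] becomes one for the program by changing block [i] alone. [Y'] is taken
    block diagonal: constraints and objective read only diagonal blocks, whereas exchanging a block
    inside [Y] could destroy definiteness. *)
Lemma node_ric_maximal i : ric_maximal (A (node i)) (B (node i)) Q Rw (P i) (K i).
Proof.
have [[Yp YW] Ymax] := hYW; have Up := posdef_Yblk i Yp.
split; [exact: posdef_inv|exact/lmi_ric|].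
move=> P' K' P'p ricn; rewrite /P invmxK.
pose V j := if j == i then invmx P' else Yblk Y j.
pose W' j := if j == i then K' *m invmx P' else W j.
pose Y' : 'M[R]_(\sum_(j < N.+1) n) := \mxdiag_(j < N.+1) V j.
have Y'blk j : Yblk Y' j = V j by exact: submxblock_diag.
have Vp j : posdefmx (V j).
  by rewrite /V; case: eqP => _; [exact: posdef_inv|exact: posdef_Yblk].
have Y'f : feasible D f node A B Q Rw Y' W'.
  split; first exact: posdef_mxdiag.
  move=> j; have [ji|ji] := eqVneq j i.
    apply/lmi_ric; first by rewrite Y'blk.
    rewrite Y'blk /V /W' ji eqxx invmxK.
    by rewrite -mulmxA mulVmx ?posdef_unit// mulmx1.
  have := YW j; rewrite /LMI /M11 /M12 /M13 Y'blk /V /W' (negPf ji).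
  by [].
have := Ymax _ _ Y'f; rewrite !objectiveE (bigD1 i)//= [leRHS](bigD1 i)//=.
rewrite [X in _ + X <= _](eq_bigr (fun j => w j * \tr (Yblk Y j))); last first.
  by move=> j ji; rewrite Y'blk /V (negPf ji).
by rewrite lerD2r Y'blk /V eqxx ler_pM2l// (Ep_lagrp_gt0 hf hphi hnode).
Qed.

Lemma gain_node i : gain node Y W (node i) = K i.
Proof.
have li j : lagr node j (node i) = (i == j)%:R.
  by rewrite (lagr_node hnode) eq_sym.
by rewrite /gain /Lmx (mul_tr_mxcol_scalar _ li) (submxblock_scalar _ li).
Qed.

End Optimum.

Section ClosedLoop.
Variables (x0 : 'cV[R]_n) (K : R -> 'M[R]_(m, n)) (x : R -> R -> 'cV[R]_n).
Hypothesis hx : closed_loop A B x0 K x.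

Lemma closed_loop_cont d k :
  {within `[0, +oo[, continuous (fun t : R => x t d k 0)}.
Proof. by have [_ + _] := hx d; apply. Qed.

Lemma closed_loop_deriv d (t : R) k : 0 < t ->
  is_derive t 1 (fun s : R => x s d k 0) (((A d + B d *m K d) *m x t d) k 0).
Proof. by have [_ _ +] := hx d; move=> h t0; rewrite mulmxDl -mulmxA; exact: h. Qed.

Lemma cost_nodes : cost D f node Q Rw K x =
  (\sum_(i < N.+1) (w i)%:E * \int[mu]_(t in `[0%R, +oo[)
    (quadf (Q + (K (node i))^T *m Rw *m K (node i)) (x t (node i)))%:E)%E.
Proof.
(* The mixed coefficients pair gains of different nodes; at [i = j] this is the running cost of the
   node. *)
pose c i j t := bilf (Q + (K (node i))^T *m Rw *m K (node j))
  (x t (node i)) (x t (node j)).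
have cE t d : quadf Q (x_sc node x t d) + quadf Rw (u_sc node K x t d) =
    (colloc_poly node (fun i j => c i j t)).[d].
  rewrite !quadf_expansion !colloc_polyE -big_split; apply: eq_bigr => i _ /=.
  rewrite -big_split; apply: eq_bigr => j _ /=; rewrite -mulrDl; congr (_ * _).
  by rewrite /c /bilf trmx_mul mulmxDr mulmxDl addmxE !mulmxA.
have xm d k : measurable_fun (`[0%R, +oo[ : set (measurableTypeR R))
    (fun t => x t d k 0).
  by apply: subspace_continuous_measurable_fun => //; exact: closed_loop_cont.
rewrite -(expected_cost (c := c) hf hphi hnode).
- by rewrite /cost; congr Exe; apply/funext => d; apply: eq_integral => t _; rewrite cE.
- move=> i j; rewrite (_ : c i j = fun t => \sum_a \sum_b
      (Q + (K (node i))^T *m Rw *m K (node j)) a b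
      * (x t (node i) a 0 * x t (node j) b 0)); last first.
    by apply/funext => t; rewrite /c bilf_sumE.
  apply: measurable_sum => a; apply: measurable_sum => b.
  apply: measurable_funM; first exact: measurable_cst.
  by apply: measurable_funM; exact: xm.
- move=> i t _; rewrite /c -quadfE.
  have [_] : psdmx (Q + (K (node i))^T *m Rw *m K (node i)); last by [].
  by apply: psdmxD => //; exact: psdmx_congr.
- by move=> t d _; rewrite -cE addr_ge0//; [have [_] := hQ|have [_] := hR].
Qed.

Lemma mean_square_nodes t : Ex D f (fun d => quadf 1%:M (x_sc node x t d)) =
  \sum_(i < N.+1) w i * quadf 1%:M (x t (node i)).
Proof.
rewrite -(Ep_colloc hf hphi hnode
  (fun i j => bilf 1%:M (x t (node i)) (x t (node j)))).
by apply: eq_Rintegral => d _; rewrite quadf_expansion.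
Qed.

(** The mean square is a sum of squared norms at the nodes with positive weights, so it tends to 0
    exactly when every summand does. *)
Lemma regulated_nodes :
  regulated D f node x <-> forall i, mcvg +oo%R (x ^~ (node i)) 0.
Proof.
have w0 i := Ep_lagrp_gt0 hf hphi hnode i.
have -> : regulated D f node x =
    (\sum_(i < N.+1) w i * quadf 1%:M (x t (node i)) @[t --> +oo] --> (0 : R)).
  by rewrite /regulated; under eq_fun do rewrite mean_square_nodes.
split=> [reg i a b|xc].
- rewrite ord1 mxE.
  apply/cvgrPdist_lt => e e0.
  have we0 : 0 < w i * e ^+ 2 by rewrite mulr_gt0 ?exprn_gt0.
  near=> t.
  have St : \sum_(i < N.+1) w i * quadf 1%:M (x t (node i)) < w i * e ^+ 2.
    by near: t; apply: (cvgr_lt _ reg).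
  rewrite sub0r normrN ltNge; apply/negP => exn.
  have ex : e ^+ 2 <= x t (node i) a 0 ^+ 2.
    rewrite -(real_normK (num_real (x t (node i) a 0))).
    by have := normr_ge0 (x t (node i) a 0); nra.
  move: St; rewrite ltNge => /negP; apply.
  rewrite (bigD1 i)//=; apply: ler_wpDr.
    by apply: sumr_ge0 => j _; rewrite mulr_ge0 ?quadf1_ge0// ltW.
  rewrite ler_pM2l//; apply: le_trans ex _; rewrite quadf1 (bigD1 a)//= lerDl.
  by apply: sumr_ge0 => k _; exact: sqr_ge0.
- have S0 : \sum_(i < N.+1) w i * quadf 1%:M (0 : 'cV[R]_n) = 0.
    by rewrite big1// => i _; rewrite quadf_0r mulr0.
  rewrite -[X in _ --> X]S0.
  apply: (@cvg_sumr R R (pinfty_nbhs R) _ _ _ _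
    (fun i t => w i * quadf 1%:M (x t (node i)))) => i _.
  apply: cvgM; first exact: cvg_cst.
  exact: (mcvg_quadf _ (@mcvg_cst _ _ _ _ _ _ 1%:M) (xc i)).
Unshelve. all: by end_near. Qed.

End ClosedLoop.

End Assembly.

Theorem theorem5 (R : realType) (n m N : nat)
    (D : set R) (f : R -> R) (hf : is_density D f)
    (phi : nat -> {poly R}) (hphi : is_pc_basis D f phi)
    (node : 'I_N.+1 -> R) (hnode : are_roots (phi N.+1) node)
    (A : R -> 'M[R]_n) (B : R -> 'M[R]_(n, m))
    (Q : 'M[R]_n) (Rw : 'M[R]_m) (hQ : psdmx Q) (hR : psdmx Rw)
    (x0 : 'cV[R]_n)
    (Y : 'M[R]_(\sum_(i < N.+1) n)) (W : 'I_N.+1 -> 'M[R]_(m, n))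
    (hYW : solves_program D f node A B Q Rw Y W) :
  minimizes_cost D f node A B Q Rw x0 (gain node Y W).
Proof.
move=> x hx; set K := gain node Y W in hx *.
have PK i := node_ric_maximal hf hphi hnode hQ hR hYW i.
have opt i := node_optimal_cost hQ hR (PK i) (x := x ^~ (node i)).
have Kn i : K (node i) = W i *m invmx (Yblk Y i) by exact: gain_node hnode _ _ _.
have {}opt i : mcvg +oo%R (x ^~ (node i)) 0 /\
    (\int[lebesgue_measure]_(t in `[0%R, +oo[)
      (quadf (Q + (K (node i))^T *m Rw *m K (node i)) (x t (node i)))%:E =
     (quadf (invmx (Yblk Y i)) x0)%:E)%E.
  have [xi0 _ _] := hx (node i); rewrite -xi0 Kn; apply: opt.
    by move=> k; exact: (closed_loop_cont hx).
  by move=> t k t0; rewrite -Kn; exact: (closed_loop_deriv hx).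
split; first by apply/(regulated_nodes hf hphi hnode) => i; have [] := opt i.
move=> K' x' hx' hreg.
rewrite (cost_nodes hf hphi hnode hQ hR hx) (cost_nodes hf hphi hnode hQ hR hx').
(* Both costs carry the same nonnegative weights, so nodes are compared one by one. *)
apply: lee_sum => i _; apply: lee_wpmul2l.
  by rewrite lee_fin; apply: ltW; exact: (Ep_lagrp_gt0 hf hphi hnode i).
have [_ ->] := opt i; have [x'i0 _ _] := hx' (node i); rewrite -x'i0.
apply: (node_cost_ge hQ hR (PK i) (x := x' ^~ (node i))).
- by move=> k; exact: (closed_loop_cont hx').
- by move=> t k t0; exact: (closed_loop_deriv hx').
- case: hreg => [|/(regulated_nodes hf hphi hnode)]; first by left.
  by right.
Qed.
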